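(* Let $K$ be a field, $E=K\langle e_1,\dots,e_n\rangle$ the exterior algebra, and let $0\neq M\in\mathcal{M}$. A sequence $v_1,\dots,v_s\in E_1$ is an $M$-regular sequence if and only if it is an $M^*$-regular sequence. In particular, $$\operatorname{depth}M=\operatorname{depth}M^*\quad\text{and}\quad \operatorname{cx}M=\operatorname{cx}M^*.$$
   Context: $E$ is standard graded with $\deg e_i=1$. $\mathcal{M}$ is the category of finitely generated graded left and right $E$-modules $M$ with $am=(-1)^{\deg a\deg m}ma$ for homogeneous $a,m$. $M^*=\operatorname{Hom}_E(M,E)$ is the dual of $M$. An element $v\in E_1$ is $M$-regular if $0:_Mv=vM$; a sequence $v_1,\dots,v_s\in E_1$ is $M$-regular if $v_i$ is $M/(v_1,\dots,v_{i-1})M$-regular for each $i$ and $M/(v_1,\dots,v_s)M\neq 0$; $\operatorname{depth}M$ is the common length of all maximal $M$-regular sequences. With $\beta_i(M)=\sum_j\dim_K\operatorname{Tor}^E_i(K,M)_j$, the complexity is $\operatorname{cx}M=\inf\{c\in\mathbb{N}:\exists\alpha\in\mathbb{R},\ \beta_i(M)\leq\alpha i^{c-1}\ \forall i\geq1\}$. *)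

(* Defs.v *)
From HB Require Import structures.
From mathcomp Require Import all_boot all_order all_algebra.
From mathcomp Require Import all_classical all_reals ereal.
From mathcomp Require Import zify ring.

Set Implicit Arguments.
Unset Strict Implicit.
Unset Printing Implicit Defensive.

Import Order.TTheory GRing.Theory Num.Theory.

Local Open Scope ring_scope.

(* x : extalg K n is \sum_A x A e_A with e_A = e_{i_1} ... e_{i_p} for
   A = {i_1 < ... < i_p}; e_A e_B is 0 when A and B meet, and otherwise
   (-1)^(inversions A B) e_{A U B}. *)
Definition inversions (n : nat) (A B : {set 'I_n}) : nat :=
  (\sum_(i in A) \sum_(j in B) (j < i))%N.

Lemma inversionsUl n (A B C : {set 'I_n}) : [disjoint A & B] ->
  inversions (A :|: B) C = (inversions A C + inversions B C)%N.
Proof.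
move=> dAB; rewrite /inversions -bigU //=.
by apply: eq_bigl => i; rewrite finset.in_setU.
Qed.

Lemma inversionsUr n (A B C : {set 'I_n}) : [disjoint B & C] ->
  inversions A (B :|: C) = (inversions A B + inversions A C)%N.
Proof.
move=> dBC; rewrite /inversions -big_split /=.
apply: eq_bigr => i _; rewrite -bigU //=.
by apply: eq_bigl => j; rewrite finset.in_setU.
Qed.

Definition extalg (K : fieldType) (n : nat) : Type := {ffun {set 'I_n} -> K^o}.

Section ExtAlg.
Variables (K : fieldType) (n : nat).
Local Notation E := (extalg K n).
Implicit Types (A B C D : {set 'I_n}) (x y z : E).

HB.instance Definition _ := Vector.copy E {ffun {set 'I_n} -> K^o}.

Definition ext_coef A B C : K :=
  if [disjoint A & B] && (A :|: B == C) then (-1) ^+ inversions A B else 0.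

Definition ext_one : E := [ffun A => (A == finset.set0)%:R].
Definition ext_mul x y : E :=
  [ffun C => \sum_A \sum_B ext_coef A B C * (x A * y B)].

Lemma sum_ext_coef A B (F : {set 'I_n} -> K) :
  \sum_D ext_coef A B D * F D =
  if [disjoint A & B] then (-1) ^+ inversions A B * F (A :|: B) else 0.
Proof.
rewrite /ext_coef; case: ifP => dAB /=; last first.
  by rewrite big1 // => D _; rewrite mul0r.
rewrite (bigD1 (A :|: B)) //= eqxx big1 ?addr0 // => D neD.
by rewrite eq_sym (negPf neD) mul0r.
Qed.

Lemma ext_coefA A B C D :
  \sum_F ext_coef A B F * ext_coef F C D = \sum_F ext_coef B C F * ext_coef A F D.
Proof.
rewrite !sum_ext_coef /ext_coef.
have [dAB|dAB] := boolP [disjoint A & B]; have [dBC|dBC] := boolP [disjoint B & C].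
- have -> : [disjoint A :|: B & C] = [disjoint A & B :|: C].
    move: dAB dBC; rewrite -!finset.setI_eq0 finset.setIUl finset.setIUr !finset.setU_eq0.
    by move=> -> ->; rewrite andbT.
  rewrite finset.setUA; case: ifP => //; last by rewrite !mulr0.
  rewrite -!exprD => /andP[dABC _].
  rewrite inversionsUl // inversionsUr // addnCA.
  by congr (_ ^+ _); lia.
- rewrite (_ : [disjoint A :|: B & C] = false) ?mulr0 //.
  by apply: contraNF dBC => /disjointWl; apply; apply/fintype.subsetP=> i; rewrite !inE => ->; rewrite orbT.
- rewrite (_ : [disjoint A & B :|: C] = false) ?mulr0 //.
  by apply: contraNF dAB => /disjointWr; apply; apply/fintype.subsetP=> i; rewrite !inE => ->.
- by [].
Qed.

Lemma ext_mulA : associative ext_mul.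
Proof.
move=> x y z; apply/ffunP => D; rewrite !ffunE.
have -> : \sum_A \sum_B ext_coef A B D * (x A * ext_mul y z B)
  = \sum_A \sum_B \sum_C (x A * y B * z C) * \sum_F ext_coef B C F * ext_coef A F D.
  apply: eq_bigr => A _.
  under eq_bigr => F _.
    rewrite ffunE !mulr_sumr; under eq_bigr do rewrite !mulr_sumr.
    over.
  rewrite exchange_big; apply: eq_bigr => B _ /=; rewrite exchange_big; apply: eq_bigr => C _ /=.
  rewrite mulr_sumr; apply: eq_bigr => F _.
  by rewrite /=; ring.
under eq_bigr => A _ do under eq_bigr => B _ do under eq_bigr => C _ do rewrite -ext_coefA.
under [in RHS]eq_bigr => F _.
  under eq_bigr => C _.
    rewrite ffunE mulr_suml mulr_sumr; under eq_bigr do rewrite mulr_suml mulr_sumr.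
    over.
  rewrite exchange_big; under eq_bigr do rewrite exchange_big.
  over.
rewrite [RHS]exchange_big; apply: eq_bigr => A _ /=.
rewrite [RHS]exchange_big; apply: eq_bigr => B _ /=.
rewrite [RHS]exchange_big; apply: eq_bigr => C _ /=.
rewrite mulr_sumr; apply: eq_bigr => F _.
by rewrite /=; ring.
Qed.

Lemma ext_mul1l : left_id ext_one ext_mul.
Proof.
move=> x; apply/ffunP => C; rewrite ffunE (bigD1 finset.set0) //= [X in _ + X]big1 ?addr0; last first.
  by move=> A /negPf neA; rewrite big1 // => B _; rewrite ffunE neA mul0r mulr0.
rewrite (bigD1 C) //= big1 ?addr0.
  by rewrite ffunE eqxx mul1r /ext_coef -finset.setI_eq0 finset.set0I eqxx finset.set0U eqxx /inversions finset.big_set0 mul1r.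
move=> B /negPf neB; rewrite /ext_coef finset.set0U neB andbF mul0r //.
Qed.

Lemma ext_mul1r : right_id ext_one ext_mul.
Proof.
move=> x; apply/ffunP => C; rewrite ffunE (bigD1 C) //= [X in _ + X]big1 ?addr0; last first.
  move=> A /negPf neA; rewrite big1 // => B _; rewrite ffunE.
  have [->|] := eqVneq B finset.set0; last by rewrite mulr0 mulr0.
  by rewrite /ext_coef finset.setU0 neA andbF mul0r.
rewrite (bigD1 finset.set0) //= big1 ?addr0.
  rewrite ffunE eqxx mulr1 /ext_coef finset.setU0 eqxx andbT -finset.setI_eq0 finset.setI0 eqxx /inversions.
  by rewrite big1 ?mul1r // => i _; rewrite finset.big_set0.
by move=> B /negPf neB; rewrite ffunE neB !mulr0.
Qed.

Lemma ext_mulDl : left_distributive ext_mul +%R.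
Proof.
move=> x y z; apply/ffunP=> C; rewrite !ffunE -big_split; apply: eq_bigr => A _ /=.
by rewrite -big_split; apply: eq_bigr => B _ /=; rewrite ffunE mulrDl mulrDr.
Qed.

Lemma ext_mulDr : right_distributive ext_mul +%R.
Proof.
move=> x y z; apply/ffunP=> C; rewrite !ffunE -big_split; apply: eq_bigr => A _ /=.
by rewrite -big_split; apply: eq_bigr => B _ /=; rewrite ffunE !mulrDr.
Qed.

Lemma ext_oner_neq0 : ext_one != 0.
Proof.
by apply/eqP => /ffunP/(_ finset.set0); rewrite !ffunE eqxx => /eqP; rewrite oner_eq0.
Qed.

HB.instance Definition _ := GRing.Zmodule_isNzRing.Build E
  ext_mulA ext_mul1l ext_mul1r ext_mulDl ext_mulDr ext_oner_neq0.

Lemma ext_scalerAl (c : K) x y : c *: (x * y) = (c *: x) * y.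
Proof.
apply/ffunP=> C; rewrite !ffunE scaler_sumr; apply: eq_bigr => A _.
rewrite scaler_sumr; apply: eq_bigr => B _; rewrite ffunE.
by rewrite -[_ *: _]/(_ * _) mulrCA; congr (_ * _); rewrite mulrA.
Qed.

Lemma ext_scalerAr (c : K) x y : c *: (x * y) = x * (c *: y).
Proof.
apply/ffunP=> C; rewrite !ffunE scaler_sumr; apply: eq_bigr => A _.
rewrite scaler_sumr; apply: eq_bigr => B _; rewrite ffunE.
by rewrite -[_ *: _]/(_ * _) mulrCA; congr (_ * _); rewrite mulrCA.
Qed.

HB.instance Definition _ := GRing.Lmodule_isLalgebra.Build K E ext_scalerAl.
HB.instance Definition _ := GRing.Lalgebra_isAlgebra.Build K E ext_scalerAr.

End ExtAlg.

Section Grading.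
Variables (K : fieldType) (n : nat).
Local Notation E := (extalg K n).
Implicit Types (A B C : {set 'I_n}) (x y : E) (i j : int).

Definition ext_homog (j : int) : set E :=
  [set x : E | forall A : {set 'I_n}, x A != 0 -> #|A|%:Z = j]%classic.

Definition ext_comp j x : E := [ffun A : {set 'I_n} => if #|A|%:Z == j then x A else 0].

Lemma ext_homog0 j : ext_homog j 0.
Proof. by move=> A; rewrite ffunE eqxx. Qed.

Lemma ext_homogD j x y : ext_homog j x -> ext_homog j y -> ext_homog j (x + y).
Proof.
move=> hx hy A; rewrite ffunE; have [->|/hx//] := eqVneq (x A) 0.
by rewrite add0r => /hy.
Qed.

Lemma ext_comp_homog j x : ext_homog j (ext_comp j x).
Proof. by move=> A; rewrite ffunE; case: ifP => [/eqP//|_]; rewrite eqxx. Qed.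

Lemma ext_comp_id j x : ext_homog j x -> ext_comp j x = x.
Proof.
move=> hx; apply/ffunP => A; rewrite ffunE; case: eqP => // nj.
by apply/eqP; apply: contraT => nz; case: nj; apply: hx; rewrite eq_sym.
Qed.

Lemma ext_comp_neq i j x : i != j -> ext_homog i x -> ext_comp j x = 0.
Proof.
move=> nij hx; apply/ffunP => A; rewrite !ffunE; case: eqP => // Aj.
by apply/eqP; apply: contraT => /hx Ai; rewrite -Ai Aj eqxx in nij.
Qed.

Lemma ext_compD j : {morph ext_comp j : x y / x + y}.
Proof. by move=> x y; apply/ffunP => A; rewrite !ffunE; case: eqP; rewrite ?addr0. Qed.

Lemma ext_comp0 j : ext_comp j 0 = 0.
Proof. by apply: ext_comp_id; apply: ext_homog0. Qed.

Lemma ext_comp_sum j I (r : seq I) (F : I -> E) :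
  ext_comp j (\sum_(k <- r) F k) = \sum_(k <- r) ext_comp j (F k).
Proof. exact: (big_morph _ (ext_compD j) (ext_comp0 j)). Qed.

Lemma ext_comp_decomp x : x = \sum_(k < n.+1) ext_comp k x.
Proof.
apply/ffunP => A; rewrite sum_ffunE.
have lA : (#|A| < n.+1)%N by rewrite ltnS -[X in (_ <= X)%N]card_ord max_card.
rewrite (bigD1 (Ordinal lA)) //= ffunE eqxx big1 ?addr0 // => k /eqP nk.
by rewrite ffunE; case: eqP => // -[eA]; case: nk; apply: val_inj.
Qed.

Lemma ext_homogM i j x y : ext_homog i x -> ext_homog j y -> ext_homog (i + j) (x * y).
Proof.
move=> hx hy C; rewrite ffunE => nz.
have [A [B [nA nB dAB /eqP <-]]] : exists A B : {set 'I_n},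
    [/\ x A != 0, y B != 0, [disjoint A & B] & A :|: B == C].
  apply: contrapT => no; case/eqP: nz; rewrite big1 // => A _; rewrite big1 // => B _.
  rewrite /ext_coef; case: ifP => [/andP[dAB eC]|]; last by rewrite mul0r.
  have [->|nA] := eqVneq (x A) 0; first by rewrite mul0r mulr0.
  have [->|nB] := eqVneq (y B) 0; first by rewrite !mulr0.
  by case: no; exists A, B.
move: dAB; rewrite -finset.setI_eq0 => /eqP dAB.
by rewrite cardsU dAB cards0 subn0 -(hx _ nA) -(hy _ nB) PoszD.
Qed.

Lemma ext_homog_alg (c : K) : ext_homog 0 (c%:A : E).
Proof.
move=> A; rewrite !ffunE; case: (eqVneq A) => [-> _|_]; first by rewrite cards0.
by rewrite scaler0 eqxx.
Qed.

Lemma inversionsC A B : [disjoint A & B] ->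
  (inversions A B + inversions B A = #|A| * #|B|)%N.
Proof.
move=> dAB; rewrite /inversions exchange_big /= -big_split /=.
under eq_bigr => j jB.
  rewrite -big_split /=; under eq_bigr => i iA.
    rewrite (_ : ((j < i) + (i < j))%N = 1%N); last first.
      case: ltngtP => // /val_inj eij; move/pred0P/(_ i): dAB.
      by rewrite /= iA -eij jB.
    over.
  rewrite sum1_card; over.
by rewrite sum_nat_const mulnC.
Qed.

Lemma ext_homogC (i j : int) x y : ext_homog i x -> ext_homog j y ->
  x * y = (-1) ^+ absz (i * j) * (y * x).
Proof.
move=> hx hy; rewrite -signr_odd mulr_sign.
have -> (b : bool) (z : E) : (if b then - z else z) = (-1) ^+ b *: z.
  by case: b; rewrite ?scaleN1r ?scale1r.
apply/ffunP => C; rewrite !ffunE exchange_big scaler_sumr; apply: eq_bigr => B _ /=.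
rewrite scaler_sumr; apply: eq_bigr => A _ /=.
have [->|/hx iA] := eqVneq (x A) 0; first by rewrite mul0r !mulr0 scaler0.
have [->|/hy jB] := eqVneq (y B) 0; first by rewrite mul0r !mulr0 scaler0.
rewrite -iA -jB -PoszM absz_nat signr_odd -[RHS]/(_ * _).
rewrite /ext_coef disjoint_sym finset.setUC; case: ifP => [/andP[dBA _]|_]; last first.
  by rewrite !mul0r mulr0.
rewrite -inversionsC 1?disjoint_sym // exprD.
by rewrite -mulrA (mulrA _ _ (y B * x A)) -expr2 sqrr_sign mul1r (mulrC (y B)).
Qed.

End Grading.

Lemma signr_abszD (R : pzRingType) (i j : int) :
  (-1) ^+ absz (i + j) = (-1) ^+ absz i * (-1) ^+ absz j :> R.
Proof.
rewrite -exprD -signr_odd -[RHS]signr_odd; congr (_ ^+ _); congr (nat_of_bool _).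
lia.
Qed.

(* The compatibilities (a m) b = a (m b) and M_j E_i <= M_{i+j} follow from
   gr_scale, gr_sign and gr_span. *)
Record gmod (K : fieldType) (n : nat) := GMod {
  gm_car :> lmodType (extalg K n);
  ract : gm_car -> extalg K n -> gm_car;
  gr : int -> set gm_car;
  ractDl : forall m m' a, ract (m + m') a = ract m a + ract m' a;
  ractDr : forall m a b, ract m (a + b) = ract m a + ract m b;
  ractA : forall m a b, ract (ract m a) b = ract m (a * b);
  ract1 : forall m, ract m 1 = m;
  gr0 : forall j, gr j 0;
  grD : forall j m m', gr j m -> gr j m' -> gr j (m + m');
  gr_scale : forall i j a m, ext_homog i a -> gr j m -> gr (i + j) (a *: m);
  gr_sign : forall i j a m, ext_homog i a -> gr j m ->
    a *: m = (-1) ^+ absz (i * j) *: ract m a;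
  gr_span : forall m, exists (s : seq int) (x : int -> gm_car),
    [/\ uniq s, forall j, gr j (x j) & m = \sum_(j <- s) x j];
  gr_indep : forall (s : seq int) (x : int -> gm_car), uniq s ->
    (forall j, gr j (x j)) -> \sum_(j <- s) x j = 0 -> forall j, j \in s -> x j = 0;
  gm_fg : exists (r : nat) (g : 'I_r -> gm_car),
    forall m, exists a : 'I_r -> extalg K n, m = \sum_k a k *: g k
}.

Section GmodTheory.
Variables (K : fieldType) (n : nat) (M : gmod K n).
Local Notation E := (extalg K n).
Implicit Types (m : M) (a b : E).

Lemma ract0l a : ract (0 : M) a = 0.
Proof. by apply: (addIr (ract 0 a)); rewrite -ractDl !add0r. Qed.

Lemma ract0r m : ract m 0 = 0.
Proof. by apply: (addIr (ract m 0)); rewrite -ractDr !add0r. Qed.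

Lemma ractNl m a : ract (- m) a = - ract m a.
Proof. by apply: (addIr (ract m a)); rewrite -ractDl !addNr ract0l. Qed.

Lemma ract_suml I (r : seq I) (F : I -> M) a :
  ract (\sum_(k <- r) F k) a = \sum_(k <- r) ract (F k) a.
Proof. exact: (big_morph (fun m => ract m a) (fun m m' => ractDl m m' a) (ract0l a)). Qed.

Lemma ract_sumr I (r : seq I) (F : I -> E) m :
  ract m (\sum_(k <- r) F k) = \sum_(k <- r) ract m (F k).
Proof. exact: (big_morph (ract m) (ractDr m) (ract0r m)). Qed.

Lemma gr_algl j (c : K) m : gr j m -> gr j ((c%:A : E) *: m).
Proof. by move=> hm; rewrite -[j]add0r; apply: gr_scale => //; apply: ext_homog_alg. Qed.

Lemma gr_signl j (k : nat) m : gr j m -> gr j ((-1 : E) ^+ k *: m).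
Proof.
move=> hm; have -> : (-1 : E) ^+ k = ((-1) ^+ k : K)%:A; last exact: gr_algl.
by rewrite -in_algE rmorphXn rmorphN1.
Qed.

Lemma ext_signK (k : nat) (N : lmodType E) (m : N) : (-1 : E) ^+ k *: ((-1) ^+ k *: m) = m.
Proof. by rewrite scalerA -expr2 sqrr_sign scale1r. Qed.

Lemma gr_signr i j a m : ext_homog i a -> gr j m ->
  ract m a = (-1) ^+ absz (i * j) *: (a *: m).
Proof. by move=> ha hm; rewrite (gr_sign ha hm) ext_signK. Qed.

Lemma gr_ind (P : M -> Prop) : P 0 -> (forall m m', P m -> P m' -> P (m + m')) ->
  (forall j m, gr j m -> P m) -> forall m, P m.
Proof.
move=> P0 PD Pg m; have [s [x [_ gx ->]]] := gr_span m.
by apply: (big_ind P) => // j _; apply: Pg _ _ (gx j).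
Qed.

Lemma ext_ind (P : E -> Prop) : P 0 -> (forall a b, P a -> P b -> P (a + b)) ->
  (forall (i : int) a, ext_homog i a -> P a) -> forall a, P a.
Proof.
move=> P0 PD Pg a; rewrite (ext_comp_decomp a).
by apply: (big_ind P) => // j _; exact: (Pg _ _ (@ext_comp_homog _ _ j a)).
Qed.

Lemma ract_scalel a b m : ract (a *: m) b = a *: ract m b.
Proof.
elim/gr_ind: m a b => [a b|m m' IH IH' a b|j m hm].
- by rewrite scaler0 ract0l scaler0.
- by rewrite scalerDr !ractDl scalerDr IH IH'.
elim/ext_ind=> [b|a a' IH IH' b|i a ha].
- by rewrite !scale0r ract0l.
- by rewrite !scalerDl ractDl IH IH'.
elim/ext_ind=> [|b b' IH IH'|k b hb].
- by rewrite !ract0r scaler0.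
- by rewrite !ractDr scalerDr IH IH'.
rewrite (gr_signr hb (gr_scale ha hm)) (gr_signr hb hm).
rewrite !scalerA (ext_homogC hb ha) mulrDr signr_abszD.
have c (e : nat) (x : E) : x * (-1) ^+ e = (-1) ^+ e * x by apply: commr_sign.
rewrite -!mulrA; congr (_ *: _).
rewrite [RHS]mulrA c -[RHS]mulrA mulrA (c _ ((-1) ^+ absz (k * i))) -mulrA.
by rewrite (mulrA _ _ (a * b)) -expr2 sqrr_sign mul1r.
Qed.

Lemma ract_alg (c : K) m : ract m c%:A = (c%:A : E) *: m.
Proof.
elim/gr_ind: m => [|m m' IH IH'|j m hm]; first by rewrite ract0l scaler0.
  by rewrite ractDl scalerDr IH IH'.
by rewrite (gr_signr (@ext_homog_alg _ _ c) hm) mul0r scale1r.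
Qed.

Definition gr_comp (j : int) m : M :=
  let s := projT1 (cid (gr_span m)) in
  if j \in s then projT1 (cid (projT2 (cid (gr_span m)))) j else 0.

Lemma gr_comp_gr j m : gr j (gr_comp j m).
Proof.
rewrite /gr_comp; case: cid => s /= hs; case: cid => x /= [us gx _].
by case: ifP => _ //; apply: gr0.
Qed.

Lemma gr_comp_sum m : exists2 s, uniq s & m = \sum_(j <- s) gr_comp j m /\
  forall j, j \notin s -> gr_comp j m = 0.
Proof.
rewrite /gr_comp; case: cid => s /= hs; case: cid => x /= [us gx em].
exists s => //; split; last by move=> j /negPf ->.
by rewrite [LHS]em; apply: eq_big_seq => j ->.
Qed.

Lemma grN j m : gr j m -> gr j (- m).
Proof. by move=> hm; rewrite -scaleN1r -[-1]expr1; apply: gr_signl. Qed.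

Lemma gr_comp_uniq m (s : seq int) (x : int -> M) : uniq s ->
  (forall j, gr j (x j)) -> m = \sum_(j <- s) x j -> (forall j, j \notin s -> x j = 0) ->
  forall j, gr_comp j m = x j.
Proof.
move=> us gx em x0 j; have [t ut [em' y0]] := gr_comp_sum m.
pose u := undup (s ++ t).
have uu : uniq u by apply: undup_uniq.
have ext (y : int -> M) (r : seq int) : uniq r -> {subset r <= u} ->
    (forall k, k \notin r -> y k = 0) -> \sum_(k <- u) y k = \sum_(k <- r) y k.
  move=> ur ru yr; rewrite [LHS](bigID (mem r)) /= [X in _ + X]big1 ?addr0 //.
  rewrite -big_filter; apply: perm_big; apply: uniq_perm => [|//|k]; first exact: filter_uniq.
  by rewrite mem_filter; case kr: (k \in r) => //=; rewrite ru.
have h : \sum_(k <- u) (gr_comp k m - x k) = 0.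
  rewrite sumrB (ext (gr_comp^~ m) t) ?(ext x s) -?em -?em' ?subrr // => k;
  by rewrite mem_undup mem_cat => ->; rewrite ?orbT.
have := gr_indep uu _ h => /(_ _ j) H.
have [ju|] := boolP (j \in u).
  by apply/subr0_eq/H => // k; apply: grD; [apply: gr_comp_gr|apply: grN].
by rewrite mem_undup mem_cat negb_or => /andP[js jt]; rewrite x0 // y0.
Qed.

Lemma gr_comp_id j m : gr j m -> gr_comp j m = m.
Proof.
move=> hm; rewrite (gr_comp_uniq (s := [:: j]) (x := fun k => if k == j then m else 0)) //.
- by rewrite eqxx.
- by move=> k; case: eqP => [->//|_]; apply: gr0.
- by rewrite big_seq1 eqxx.
- by move=> k; rewrite inE => /negPf ->.
Qed.

Lemma gr_comp_neq i j m : i != j -> gr j m -> gr_comp i m = 0.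
Proof.
move=> nij hm; rewrite (gr_comp_uniq (s := [:: j]) (x := fun k => if k == j then m else 0)) //.
- by rewrite (negPf nij).
- by move=> k; case: eqP => [->//|_]; apply: gr0.
- by rewrite big_seq1 eqxx.
- by move=> k; rewrite inE => /negPf ->.
Qed.

Lemma gr_compD j m m' : gr_comp j (m + m') = gr_comp j m + gr_comp j m'.
Proof.
have [s us [em ms]] := gr_comp_sum m; have [t ut [em' mt]] := gr_comp_sum m'.
pose u := undup (s ++ t).
have uu : uniq u by apply: undup_uniq.
have ext (y : int -> M) (r : seq int) : uniq r -> {subset r <= u} ->
    (forall k, k \notin r -> y k = 0) -> \sum_(k <- u) y k = \sum_(k <- r) y k.
  move=> ur ru yr; rewrite [LHS](bigID (mem r)) /= [X in _ + X]big1 ?addr0 //.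
  rewrite -big_filter; apply: perm_big; apply: uniq_perm => [|//|k]; first exact: filter_uniq.
  by rewrite mem_filter; case kr: (k \in r) => //=; rewrite ru.
rewrite (gr_comp_uniq (s := u) (x := fun k => gr_comp k m + gr_comp k m')) //.
- by move=> k; apply: grD; apply: gr_comp_gr.
- rewrite big_split /= (ext (gr_comp^~ m) s) ?(ext (gr_comp^~ m') t) -?em -?em' // => k;
  by rewrite mem_undup mem_cat => ->; rewrite ?orbT.
- by move=> k; rewrite mem_undup mem_cat negb_or => /andP[ks kt]; rewrite ms ?mt ?addr0.
Qed.

Lemma gr_comp0 j : gr_comp j 0 = 0.
Proof. by apply: gr_comp_id; apply: gr0. Qed.

Lemma gr_comp_scale i j a m : ext_homog i a -> gr_comp j (a *: m) = a *: gr_comp (j - i) m.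
Proof.
move=> ha; elim/gr_ind: m => [|m m' IH IH'|k m hm]; first by rewrite scaler0 !gr_comp0 scaler0.
  by rewrite scalerDr !gr_compD scalerDr IH IH'.
have ham := gr_scale ha hm.
have [->|ne] := eqVneq j (i + k).
  by rewrite gr_comp_id // addrC addKr gr_comp_id.
rewrite (gr_comp_neq ne) // (gr_comp_neq _ hm) ?scaler0 //.
by apply: contraNneq ne => <-; rewrite addrC subrK.
Qed.

Lemma gr_bounded : exists2 s : seq int, uniq s & forall m,
  m = \sum_(j <- s) gr_comp j m /\ forall j, j \notin s -> gr_comp j m = 0.
Proof.
have [r [g gen]] := gm_fg M.
have /choice [t tP] : forall k, exists t : seq int, forall j, j \notin t -> gr_comp j (g k) = 0.
  by move=> k; have [t _ [_ ?]] := gr_comp_sum (g k); exists t.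
pose s := undup [seq (i : int) + j | i <- [seq Posz k | k <- iota 0 n.+1], j <- flatten [seq t k | k <- enum 'I_r]].
have s0 j m : j \notin s -> gr_comp j m = 0.
  move=> js; have [a ->] := gen m.
  elim/big_ind: _ => [|x y hx hy|k _]; first exact: gr_comp0.
    by rewrite gr_compD hx hy addr0.
  rewrite (ext_comp_decomp (a k)) scaler_suml.
  elim/big_ind: _ => [|x y hx hy|i _]; first exact: gr_comp0.
    by rewrite gr_compD hx hy addr0.
  rewrite (gr_comp_scale _ _ (@ext_comp_homog _ _ _ _)) tP ?scaler0 //.
  apply: contra js => jt; rewrite mem_undup; apply/allpairsP; exists (Posz i, j - Posz i).
  split; last by rewrite addrC subrK.
    by apply/mapP; exists (i : nat) => //; rewrite mem_iota /= add0n.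
  by apply/flatten_mapP; exists k; rewrite ?mem_enum.
exists s; first exact: undup_uniq.
move=> m; split; last by move=> j /s0.
have [u uu [em mu]] := gr_comp_sum m.
rewrite [LHS]em (bigID (mem s)) /= [X in _ + X]big1 ?addr0; last by move=> j; apply: s0.
rewrite [RHS](bigID (mem u)) /= [X in _ = _ + X]big1 ?addr0; last by move=> j; apply: mu.
rewrite -big_filter -[RHS]big_filter; apply: perm_big; apply: uniq_perm; rewrite ?filter_uniq ?undup_uniq //.
by move=> j; rewrite !mem_filter andbC.
Qed.

End GmodTheory.

Lemma closed_span (K : fieldType) (W : vectType K) (P : W -> Prop) :
  P 0 -> (forall c x y, P x -> P y -> P (c *: x + y)) ->
  exists (r : nat) (g : 'I_r -> W), (forall k, P (g k)) /\
    forall w, P w -> exists c : 'I_r -> K, w = \sum_k c k *: g k.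
Proof.
move=> P0 PZ.
have PS (r : nat) (c : 'I_r -> K) (g : 'I_r -> W) :
    (forall k, P (g k)) -> P (\sum_k c k *: g k).
  elim: r c g => [|r IH] c g Pg; first by rewrite big_ord0.
  by rewrite big_ord_recl; apply: PZ => //; apply: IH => k.
pose Q (d : nat) := `[< exists U : {vspace W}, \dim U = d /\ forall w, w \in U -> P w >].
have exQ : exists d, Q d.
  by exists 0%N; apply/asboolP; exists 0%VS; rewrite dimv0; split=> // w; rewrite memv0 => /eqP ->.
have bQ d : Q d -> (d <= dim W)%N.
  by move=> /asboolP[U [<- _]]; rewrite -dimvf; apply/dimvS/subvf.
case: (ex_maxnP exQ bQ) => d /asboolP[U [dU PU]] maxd.
exists (\dim U), (fun k => (vbasis U)`_k); split=> [k|w Pw].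
  by apply/PU/vbasis_mem/mem_nth; rewrite size_tuple.
have wU : w \in U.
  apply: contraT => nwU.
  have := maxd (\dim (U + <[w]>)%VS); rewrite -dU => /(_ _)/wrap[].
    apply/asboolP; exists (U + <[w]>)%VS; split=> // _ /memv_addP[u uU [_ /vlineP[c ->] ->]].
    by rewrite addrC; apply: PZ => //; apply: PU.
  move=> le; have /eqP eU : U == (U + <[w]>)%VS by rewrite eqEdim addvSl.
  by case/negP: nwU; rewrite eU memvE addvSr.
by exists (fun k => coord (vbasis U) k w); rewrite {1}(coord_vbasis wU).
Qed.

(* M^* = Hom_E(M, E) consists of all left E-linear maps, with
   (a f)(m) = f(m a) and (f a)(m) = f(m) a; f has degree d when it maps each M_j
   to E_{j+d}. These satisfy the sign rule of gmod. *)
Definition dual_car (K : fieldType) (n : nat) (M : gmod K n) : Type :=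
  {linear M -> (extalg K n)^o}.

Section Dual.
Variables (K : fieldType) (n : nat) (M : gmod K n).
Local Notation E := (extalg K n).
Local Notation D := (dual_car M).
Implicit Types (f g h : D) (a b : E) (m : M).

HB.instance Definition _ := gen_eqMixin D.
HB.instance Definition _ := gen_choiceMixin D.

Definition dual_fun f : M -> E := f.

Lemma dual_ext f g : (forall m, dual_fun f m = dual_fun g m) -> f = g.
Proof.
rewrite /dual_fun; case: f g => f [[f1] [f2]] [g [[g1] [g2]]] /= /funext fg.
subst g; rewrite (Prop_irrelevance f1 g1) (Prop_irrelevance f2 g2) //.
Qed.

Lemma dual_funD f m m' : dual_fun f (m + m') = dual_fun f m + dual_fun f m'.
Proof. exact: linearD. Qed.

Lemma dual_funZ f a m : dual_fun f (a *: m) = a * dual_fun f m.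
Proof. by rewrite /dual_fun linearZ. Qed.

Lemma dual_fun0 f : dual_fun f 0 = 0.
Proof. exact: linear0. Qed.

Lemma dual_mk_subproof (F : M -> E) :
  (forall a m m', F (a *: m + m') = a * F m + F m') -> linear (F : M -> E^o).
Proof. by []. Qed.

Definition dual_mk (F : M -> E)
  (Flin : forall a m m', F (a *: m + m') = a * F m + F m') : D :=
  HB.pack_for {linear M -> E^o} (F : M -> E^o)
    (GRing.isLinear.Build E M E^o *:%R F (dual_mk_subproof Flin)).

Fact dual0_subproof a m m' : 0 = a * 0 + 0 :> E.
Proof. by rewrite mulr0 addr0. Qed.
Definition dual0 : D := dual_mk dual0_subproof.

Fact dualN_subproof f a m m' : - dual_fun f (a *: m + m') = a * - dual_fun f m + - dual_fun f m'.
Proof. by rewrite dual_funD dual_funZ opprD mulrN. Qed.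
Definition dualN f : D := dual_mk (dualN_subproof f).

Fact dualD_subproof f g a m m' : dual_fun f (a *: m + m') + dual_fun g (a *: m + m') =
  a * (dual_fun f m + dual_fun g m) + (dual_fun f m' + dual_fun g m').
Proof. by rewrite !dual_funD !dual_funZ mulrDr addrACA. Qed.
Definition dualD f g : D := dual_mk (dualD_subproof f g).

Fact dual_addA : associative dualD.
Proof. by move=> f g h; apply: dual_ext => m; apply: addrA. Qed.
Fact dual_addC : commutative dualD.
Proof. by move=> f g; apply: dual_ext => m; apply: addrC. Qed.
Fact dual_add0 : left_id dual0 dualD.
Proof. by move=> f; apply: dual_ext => m; apply: add0r. Qed.
Fact dual_addN : left_inverse dual0 dualN dualD.
Proof. by move=> f; apply: dual_ext => m; apply: addNr. Qed.

HB.instance Definition _ :=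
  GRing.isZmodule.Build D dual_addA dual_addC dual_add0 dual_addN.

Fact dualZ_subproof b f a m m' : dual_fun f (ract (a *: m + m') b) =
  a * dual_fun f (ract m b) + dual_fun f (ract m' b).
Proof. by rewrite ractDl ract_scalel dual_funD dual_funZ. Qed.
Definition dualZ b f : D := dual_mk (dualZ_subproof b f).

Fact dual_scaleA a b f : dualZ a (dualZ b f) = dualZ (a * b) f.
Proof. by apply: dual_ext => m; rewrite /dual_fun /= ractA. Qed.
Fact dual_scale1 : left_id 1 dualZ.
Proof. by move=> f; apply: dual_ext => m; rewrite /dual_fun /= ract1. Qed.
Fact dual_scaleDr : right_distributive dualZ +%R.
Proof. by move=> a f g; apply: dual_ext => m. Qed.
Fact dual_scaleDl f : {morph dualZ^~ f : a b / a + b}.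
Proof. by move=> a b; apply: dual_ext => m; rewrite /dual_fun /= ractDr dual_funD. Qed.

HB.instance Definition _ := GRing.Zmodule_isLmodule.Build E D
  dual_scaleA dual_scale1 dual_scaleDr dual_scaleDl.

Fact dual_ract_subproof f b a m m' : dual_fun f (a *: m + m') * b =
  a * (dual_fun f m * b) + dual_fun f m' * b.
Proof. by rewrite dual_funD dual_funZ mulrDl mulrA. Qed.
Definition dual_ract f b : D := dual_mk (dual_ract_subproof f b).

Definition dual_gr (d : int) : set D :=
  [set f | forall j m, gr j m -> ext_homog (j + d) (dual_fun f m)]%classic.

Fact dual_ractDl f g a : dual_ract (f + g) a = dual_ract f a + dual_ract g a.
Proof. by apply: dual_ext => m; apply: mulrDl. Qed.
Fact dual_ractDr f a b : dual_ract f (a + b) = dual_ract f a + dual_ract f b.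
Proof. by apply: dual_ext => m; apply: mulrDr. Qed.
Fact dual_ractA f a b : dual_ract (dual_ract f a) b = dual_ract f (a * b).
Proof. by apply: dual_ext => m; rewrite /dual_fun /= -mulrA. Qed.
Fact dual_ract1 f : dual_ract f 1 = f.
Proof. by apply: dual_ext => m; apply: mulr1. Qed.

Fact dual_gr0 d : dual_gr d 0.
Proof. by move=> j m _; apply: ext_homog0. Qed.
Fact dual_grD d f g : dual_gr d f -> dual_gr d g -> dual_gr d (f + g).
Proof. by move=> hf hg j m hm; apply: ext_homogD; [apply: hf|apply: hg]. Qed.

Lemma ext_homog_sign i (k : nat) (a : E) : ext_homog i a -> ext_homog i ((-1) ^+ k * a).
Proof.
move=> ha; have -> : (-1 : E) ^+ k = ((-1) ^+ k : K)%:A by rewrite -in_algE rmorphXn rmorphN1.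
by rewrite -[i]add0r; apply: ext_homogM => //; apply: ext_homog_alg.
Qed.

Fact dual_gr_scale i d a f : ext_homog i a -> dual_gr d f -> dual_gr (i + d) (a *: f).
Proof.
move=> ha hf j m hm; rewrite /dual_fun /= (gr_signr ha hm) dual_funZ.
by apply: ext_homog_sign; rewrite addrA [j + i]addrC; apply: hf; apply: gr_scale.
Qed.

Fact dual_gr_sign i d a f : ext_homog i a -> dual_gr d f ->
  a *: f = (-1) ^+ absz (i * d) *: dual_ract f a.
Proof.
move=> ha hf; apply: dual_ext => m; elim/gr_ind: m => [|m m' IH IH'|j m hm].
- by rewrite !dual_fun0.
- by rewrite !dual_funD IH IH'.
have {1}-> : (-1 : E) ^+ absz (i * d) = ((-1) ^+ absz (i * d) : K)%:A.
  by rewrite -in_algE rmorphXn rmorphN1.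
rewrite /dual_fun /= ract_alg -/(dual_fun f) (gr_signr ha hm) !dual_funZ.
have -> : ((-1) ^+ absz (i * d) : K)%:A = (-1 : E) ^+ absz (i * d).
  by rewrite -in_algE rmorphXn rmorphN1.
rewrite (ext_homogC ha (hf _ _ hm)) mulrDr signr_abszD !mulrA -expr2 sqrr_sign mul1r.
by rewrite -!mulrA.
Qed.

Fact dual_gr_indep (s : seq int) (x : int -> D) : uniq s ->
  (forall d, dual_gr d (x d)) -> \sum_(d <- s) x d = 0 -> forall d, d \in s -> x d = 0.
Proof.
move=> us gx s0 d ds; apply: dual_ext => m; rewrite [RHS]/(0 : E).
elim/gr_ind: m => [|m m' IH IH'|j m hm]; first by rewrite dual_fun0.
  by rewrite dual_funD IH IH' addr0.
have sumE (r : seq int) : dual_fun (\sum_(d <- r) x d) m = \sum_(d <- r) dual_fun (x d) m.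
  exact: (big_morph (fun f : D => dual_fun f m) (fun _ _ => erefl) erefl).
have := sumE s; rewrite s0 => /(congr1 (ext_comp (j + d))).
rewrite ext_comp0 ext_comp_sum (bigD1_seq d) //= big1 ?addr0 => [|e ned].
  by rewrite ext_comp_id //; apply: gx.
by rewrite (ext_comp_neq (i := j + e)) //; [rewrite (inj_eq (addrI j))|apply: gx].
Qed.

Lemma ext_comp_mul i j a b : ext_homog i a -> ext_comp (i + j) (a * b) = a * ext_comp j b.
Proof.
move=> ha; elim/ext_ind: b => [|b b' IH IH'|k b hb].
- by rewrite mulr0 !ext_comp0 mulr0.
- by rewrite mulrDr !ext_compD mulrDr IH IH'.
have hab := ext_homogM ha hb.
have [ekj|nkj] := eqVneq k j; first by rewrite -ekj !ext_comp_id.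
rewrite (ext_comp_neq _ hb) // mulr0 (ext_comp_neq _ hab) //.
by rewrite (inj_eq (addrI i)).
Qed.

Section Component.
Variables (f : D) (s : seq int).
Hypothesis us : uniq s.
Hypothesis sP : forall m,
  m = \sum_(j <- s) gr_comp j m /\ forall j, j \notin s -> gr_comp j m = 0.

Let F d m := \sum_(j <- s) ext_comp (j + d) (dual_fun f (gr_comp j m)).

Let FD d m m' : F d (m + m') = F d m + F d m'.
Proof.
rewrite /F -big_split; apply: eq_bigr => j _ /=.
by rewrite gr_compD dual_funD ext_compD.
Qed.

Let F0 d : F d 0 = 0.
Proof. by rewrite /F big1 // => j _; rewrite gr_comp0 dual_fun0 ext_comp0. Qed.

Let gr_out j m : j \notin s -> gr j m -> m = 0.
Proof. by move=> js hm; rewrite -(gr_comp_id hm); have [_ ->] := sP m. Qed.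

Let Fg d j m : gr j m -> F d m = ext_comp (j + d) (dual_fun f m).
Proof.
move=> hm; have [js|js] := boolP (j \in s); last first.
  by rewrite (gr_out js hm) F0 dual_fun0 ext_comp0.
rewrite /F (bigD1_seq j) //= gr_comp_id // big1 ?addr0 // => k nkj.
by rewrite (gr_comp_neq nkj hm) dual_fun0 ext_comp0.
Qed.

Fact dual_comp_subproof d a m m' : F d (a *: m + m') = a * F d m + F d m'.
Proof.
rewrite FD; congr (_ + _).
elim/gr_ind: m a => [a|m1 m2 IH1 IH2 a|j m1 hm]; first by rewrite scaler0 F0 mulr0.
  by rewrite scalerDr !FD mulrDr IH1 IH2.
elim/ext_ind => [|a b IHa IHb|i a ha]; first by rewrite scale0r F0 mul0r.
  by rewrite scalerDl FD mulrDl IHa IHb.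
by rewrite (Fg _ (gr_scale ha hm)) (Fg _ hm) dual_funZ -addrA ext_comp_mul.
Qed.

Definition dual_comp d : D := dual_mk (dual_comp_subproof d).

Lemma dual_comp_gr d : dual_gr d (dual_comp d).
Proof.
by move=> j m hm; rewrite [X in ext_homog _ X](Fg d hm); apply: ext_comp_homog.
Qed.

Lemma dual_comp_sum : exists S : seq int, uniq S /\ f = \sum_(d <- S) dual_comp d.
Proof.
exists (undup [seq i - j | i <- [seq Posz k | k <- iota 0 n.+1], j <- s]).
split; first exact: undup_uniq.
set S := undup _; apply: dual_ext.
have sumE (r : seq int) m : dual_fun (\sum_(d <- r) dual_comp d) m = \sum_(d <- r) F d m.
  exact: (big_morph (fun f : D => dual_fun f m) (fun _ _ => erefl) erefl).
elim/gr_ind => [|m m' IH IH'|j m hm]; first by rewrite !dual_fun0.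
  by rewrite !dual_funD IH IH'.
rewrite sumE; under eq_bigr do rewrite (Fg _ hm).
have [js|js] := boolP (j \in s); last first.
  by rewrite (gr_out js hm) dual_fun0 big1 // => d _; rewrite ext_comp0.
apply/ffunP => A; rewrite sum_ffunE.
have AS : #|A|%:Z - j \in S.
  rewrite mem_undup; apply/allpairsP; exists (Posz #|A|, j); split=> //.
  apply/mapP; exists #|A| => //; rewrite mem_iota /= add0n ltnS.
  by rewrite -[X in (_ <= X)%N]card_ord max_card.
have jA : j + (#|A|%:Z - j) = #|A|%:Z by rewrite addrC subrK.
rewrite (bigD1_seq (#|A|%:Z - j)) ?undup_uniq //= ffunE jA eqxx.
rewrite big1 ?addr0 // => d nd; rewrite ffunE; case: eqP => // eA.
by rewrite eA addrC addKr eqxx in nd.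
Qed.

End Component.

Fact dual_gr_span f : exists (s : seq int) (x : int -> D),
  [/\ uniq s, forall d, dual_gr d (x d) & f = \sum_(d <- s) x d].
Proof.
have [s us sP] := gr_bounded M.
have [S [uS fS]] := dual_comp_sum f us sP.
by exists S, (dual_comp f us sP); split=> // d; apply: dual_comp_gr.
Qed.

Fact dual_fg : exists (r : nat) (g : 'I_r -> D),
  forall f, exists a : 'I_r -> E, f = \sum_k a k *: g k.
Proof.
have [r [g gen]] := gm_fg M.
pose ev f : {ffun 'I_r -> E} := [ffun k => dual_fun f (g k)].
have ev_inj f f' : ev f = ev f' -> f = f'.
  move=> /ffunP ee; apply: dual_ext => m; have [a ->] := gen m.
  have sumE (h : D) : dual_fun h (\sum_k a k *: g k) = \sum_k a k * dual_fun h (g k).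
    by rewrite (big_morph (dual_fun h) (dual_funD h) (dual_fun0 h)); apply: eq_bigr => k _; apply: dual_funZ.
  by rewrite !sumE; apply: eq_bigr => k _; have := ee k; rewrite !ffunE => ->.
have evD f f' : ev (f + f') = ev f + ev f'.
  by apply/ffunP => k; rewrite !ffunE.
have evZ (c : K) f : ev ((c%:A : E) *: f) = c *: ev f.
  apply/ffunP => k; rewrite !ffunE /dual_fun /= ract_alg -/(dual_fun f).
  by rewrite dual_funZ mulr_algl.
have ev0 : ev 0 = 0 by apply/ffunP => k; rewrite !ffunE.
have [||q [w [Pw sp]]] := @closed_span K {ffun 'I_r -> E} (fun w => exists f, w = ev f).
- by exists 0; rewrite ev0.
- by move=> c _ _ [f ->] [f' ->]; exists ((c%:A : E) *: f + f'); rewrite evD evZ.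
have /choice [h hP] := Pw.
exists q, h => f; have [|c ec] := sp (ev f); first by exists f.
exists (fun k => (c k)%:A); apply: ev_inj; rewrite ec.
rewrite (big_morph ev evD ev0); apply: eq_bigr => k _.
by rewrite evZ hP.
Qed.

Definition dual : gmod K n := @GMod K n D dual_ract dual_gr
  dual_ractDl dual_ractDr dual_ractA dual_ract1 dual_gr0 dual_grD
  dual_gr_scale dual_gr_sign dual_gr_span dual_gr_indep dual_fg.

End Dual.

Section RegularSequences.
Variables (K : fieldType) (n : nat) (M : gmod K n).
Local Notation E := (extalg K n).
Implicit Types (v : E) (vs : seq E).

(* (v_1, ..., v_s)M = v_1 M + ... + v_s M: for v in E_1 the set v M is already a
   submodule, because a v = (-1)^(deg a) v a for homogeneous a. *)
Definition seq_mul vs : set M :=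
  [set m | exists x : nat -> M,
     m = \sum_(k < size vs) nth 0 vs k *: x k]%classic.

(* 0 :_Q v = v Q for the quotient Q = M / (vs)M, read off on representatives. *)
Definition regular_elt_mod vs v : Prop :=
  forall m : M, seq_mul vs (v *: m) <-> exists m' : M, seq_mul vs (m - v *: m').

Definition regular_seq vs : Prop :=
  [/\ forall k, (k < size vs)%N -> ext_homog 1 (nth 0 vs k),
      forall k, (k < size vs)%N -> regular_elt_mod (take k vs) (nth 0 vs k)
    & exists m : M, ~ seq_mul vs m].

Definition maximal_regular_seq vs : Prop :=
  regular_seq vs /\ forall v, ~ regular_seq (rcons vs v).

(* For M != 0 some maximal regular sequence exists, so at most one d qualifies.
   Over a finite field the maximal sequences may have different lengths; depth M
   is then undefined and takes the default value 0. *)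
Definition depth : nat :=
  xget 0%N [set d | forall vs, maximal_regular_seq vs -> size vs = d]%classic.

End RegularSequences.

(* A resolution ... -> F_1 -> F_0 -> M -> 0 with F_i the free left module
   E^(b_i) of row vectors, the k-th basis vector having degree res_deg i k; the
   differential F_{i+1} -> F_i is x |-> x *m res_diff i and the augmentation
   sends the k-th basis vector of F_0 to res_aug k. *)
Record graded_free_resolution (K : fieldType) (n : nat) (M : gmod K n) :=
  GradedFreeResolution {
  res_rank : nat -> nat;
  res_deg : forall i, 'I_(res_rank i) -> int;
  res_aug : 'I_(res_rank 0) -> M;
  res_diff : forall i, 'M[extalg K n]_(res_rank i.+1, res_rank i);
  res_aug_homog : forall k, gr (res_deg k) (res_aug k);
  res_diff_homog : forall i k l,
    ext_homog (res_deg k - res_deg l) (res_diff i k l);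
  res_aug_surj : forall m : M,
    exists x : 'rV_(res_rank 0), m = \sum_k x ord0 k *: res_aug k;
  res_exact0 : forall x : 'rV_(res_rank 0),
    \sum_k x ord0 k *: res_aug k = 0 <-> exists y, x = y *m res_diff 0;
  res_exact : forall i (x : 'rV_(res_rank i.+1)),
    x *m res_diff i = 0 <-> exists y, x = y *m res_diff i.+1
}.

Section Tor.
Variables (K : fieldType) (n : nat) (M : gmod K n).

(* K (x)_E F_i is the row space K^(b_i), where K = E / (e_1, ..., e_n) via the
   coefficient of 1 = e_{set0}. *)
Section FromResolution.
Variable F : graded_free_resolution M.

Definition tor_diff i : 'M[K]_(res_rank F i.+1, res_rank F i) :=
  map_mx (fun x : extalg K n => x finset.set0) (res_diff F i).

Definition tor_cycles i : 'M[K]_(res_rank F i) :=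
  match i with 0%N => 1%:M | i'.+1 => kermx (tor_diff i') end.

Definition tor_strand i (j : int) : 'M[K]_(res_rank F i) :=
  diag_mx (\row_k (res_deg (g := F) k == j)%:R).

Definition res_tor_dim (i : nat) (j : int) : nat :=
  (\rank (tor_strand i j :&: tor_cycles i) -
   \rank (tor_strand i j :&: tor_diff i))%N.

End FromResolution.

(* dim_K Tor_i^E(K, M)_j, computed from any graded free resolution of M. *)
Definition tor_dim : nat -> int -> nat :=
  xget (fun _ _ => 0%N)
    [set t | exists F : graded_free_resolution M, t = res_tor_dim F]%classic.

Definition betti (i : nat) : nat := \sum_(j \in [set: int]%classic) tor_dim i j.

Definition complexity (R : realType) : \bar R :=
  ereal_inf [set c%:R%:E | c in [set c : nat | exists alpha : R,
    forall i, (1 <= i)%N -> (betti i)%:R <= alpha * i%:R ^ (c%:Z - 1)]]%classic.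

End Tor.

(* Main.v *)
(* Let v_0, v_1, ... in E_1 act on M. Since v_k squares to zero and the v_k anticommute, v_0 ... v_k has at most half
   the rank of v_0 ... v_(k-1) on M, and the sequence is M-regular if and only if it
   has exactly half of it for every k. As E is Frobenius, taking the top
   coefficient identifies M^* with Hom_K(M, K), where v acts, up to parity signs, by the
   transpose; transposition preserves these ranks.

   For the complexity, M^* is a retract of M^* (x)_K M (x)_K M^* (a coevaluation
   followed by an evaluation), because E is a Hopf superalgebra. Filtering the
   outer factors by degree exhibits this module as an iterated extension of (dim M)^2
   copies of M, with the action twisted by signs, so that
   beta_i(M^* ) <= (dim M)^2 beta_i(M). Applied to M^* in place of M, this gives the
   reverse bound up to a constant. Here beta_i is computed from one fixed
   free resolution of K, which makes the subadditivity on short exact sequences a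
   statement about ranks; a double complex compares it with arbitrary resolutions of M. *)
From HB Require Import structures.
Require Import Defs.
From mathcomp Require Import all_boot all_order all_algebra.
From mathcomp Require Import all_classical all_reals ereal.
From mathcomp Require Import zify ring.

Set Implicit Arguments.
Unset Strict Implicit.
Unset Printing Implicit Defensive.

Import Order.TTheory GRing.Theory Num.Theory.

Local Open Scope ring_scope.

(** * Generators and Frobenius form of the exterior algebra *)

Section ExteriorGenerators.
Variables (K : fieldType) (n : nat).
Local Notation E := (extalg K n).
Implicit Types (A B C : {set 'I_n}) (x y : E).

Definition ext_basis A : E := [ffun B => (B == A)%:R].
Definition ext_gen (i : 'I_n) : E := ext_basis [set i]%SET.

Lemma ext_sum_basis x : x = \sum_A x A *: ext_basis A.
Proof.
apply/ffunP => B; rewrite sum_ffunE (bigD1 B) //= big1 ?addr0 => [|A neA].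
  by rewrite !ffunE eqxx -[_ *: _]/(_ * _) mulr1.
by rewrite !ffunE eq_sym (negPf neA) scaler0.
Qed.

Lemma ext_basisM A B : ext_basis A * ext_basis B =
  if [disjoint A & B] then (-1) ^+ inversions A B *: ext_basis (A :|: B)%SET else 0.
Proof.
have -> : ext_basis A * ext_basis B = [ffun C => ext_coef K A B C].
  apply/ffunP => C; rewrite !ffunE (bigD1 A) //= [X in _ + X]big1 ?addr0.
    rewrite (bigD1 B) //= big1 ?addr0; first by rewrite !ffunE !eqxx !mulr1.
    by move=> D /negPf nD; rewrite !ffunE nD !mulr0.
  by move=> D /negPf nD; rewrite big1 // => F _; rewrite !ffunE nD mul0r mulr0.
apply/ffunP => C; rewrite ffunE /ext_coef; case: ifP => [/andP[-> /eqP->]|].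
  by rewrite !ffunE eqxx -[_ *: _]/(_ * _) mulr1.
move=> h; case: ifP h => [_ /= h|_ _]; last by rewrite ffunE.
by rewrite !ffunE eq_sym h scaler0.
Qed.

Lemma ext_basis0 : ext_basis finset.set0 = 1.
Proof. by apply/ffunP => A; rewrite !ffunE. Qed.

Lemma inversions_set1 (i : 'I_n) B :
  inversions [set i]%SET B = (\sum_(j in B) (j < i))%N.
Proof. by rewrite /inversions finset.big_set1. Qed.

Lemma ext_genM (i : 'I_n) B : ext_gen i * ext_basis B =
  if i \in B then 0 else (-1) ^+ (\sum_(j in B) (j < i))%N *: ext_basis (i |: B)%SET.
Proof.
by rewrite ext_basisM disjoints1 inversions_set1; case: (i \in B).
Qed.

Lemma ext_gen_homog (i : 'I_n) : ext_homog 1 (ext_gen i).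
Proof.
move=> A; rewrite ffunE; have [-> _|_] := eqVneq A; first by rewrite cards1.
by rewrite eqxx.
Qed.

Lemma ext_genC (i j : 'I_n) : ext_gen i * ext_gen j = - (ext_gen j * ext_gen i).
Proof. by rewrite (ext_homogC (@ext_gen_homog i) (@ext_gen_homog j)) mulN1r. Qed.

Lemma ext_gen_sqr (i : 'I_n) : ext_gen i * ext_gen i = 0.
Proof. by rewrite ext_genM finset.set11. Qed.

Lemma ext_basis_remove (i : 'I_n) B : i \in B ->
  ext_basis B = (-1) ^+ (\sum_(j in B :\ i) (j < i))%SET%N *: (ext_gen i * ext_basis (B :\ i)%SET).
Proof.
move=> iB; rewrite ext_genM finset.setD11 finset.setD1K //.
by rewrite scalerA -expr2 sqrr_sign scale1r.
Qed.

Lemma ext_gen_ind (P : E -> Prop) : P 0 -> P 1 ->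
  (forall c x y, P x -> P y -> P (c *: x + y)) ->
  (forall i x, P x -> P (ext_gen i * x)) -> forall x, P x.
Proof.
move=> P0 P1 PD Pg x; rewrite (ext_sum_basis x).
have Pb B : P (ext_basis B).
  move: {2}#|B| (leqnn #|B|) => k; elim: k B => [|k IH] B.
    by rewrite leqn0 cards_eq0 => /eqP ->; rewrite ext_basis0.
  move=> kB; have [->|[i iB]] := finset.set_0Vmem B; first by rewrite ext_basis0.
  rewrite (ext_basis_remove iB) -[_ *: _]addr0; apply: (PD) => //; apply: (Pg); apply: IH.
  by rewrite (cardsD1 i B) iB in kB.
by elim/big_ind: _ => // [y z Py Pz|B _]; [rewrite -[y]scale1r; apply: PD|rewrite -[_ *: _]addr0; apply: PD].
Qed.

Lemma ext_homog1_gen x : ext_homog 1 x -> x = \sum_i x [set i]%SET *: ext_gen i.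
Proof.
move=> hx; apply/ffunP => A; rewrite sum_ffunE.
have [/cards1P[i ->]|nA] := boolP (#|A| == 1)%N.
  rewrite (bigD1 i) //= big1 ?addr0 => [|j neA].
    by rewrite !ffunE eqxx -[_ *: _]/(_ * _) mulr1.
  by rewrite !ffunE (inj_eq finset.set1_inj) eq_sym (negPf neA) scaler0.
rewrite big1 => [|i _]; last first.
  rewrite !ffunE; have [eA|_] := eqVneq A; last by rewrite scaler0.
  by rewrite eA cards1 in nA.
by apply/eqP; apply: contraNT nA => /hx/eqP.
Qed.

Definition ext_top x : K := x finset.setT.

Lemma ext_top_basisM A x :
  ext_top (ext_basis A * x) = (-1) ^+ inversions A (~: A)%SET * x (~: A)%SET.
Proof.
rewrite /ext_top ffunE (bigD1 A) //= [X in _ + X]big1 ?addr0; last first.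
  by move=> D /negPf nD; rewrite big1 // => F _; rewrite !ffunE nD mul0r mulr0.
rewrite (bigD1 (~: A)%SET) //= big1 ?addr0; last first.
  move=> B nB; rewrite /ext_coef; case: ifP => [/andP[dAB /eqP uAB]|]; last by rewrite mul0r.
  case/negP: nB; rewrite finset.eqEsubset -finset.setCS finset.setCK.
  rewrite finset.subsetC -finset.disjoints_subset disjoint_sym dAB /=.
  apply/fintype.subsetP => i; rewrite finset.inE; move/finset.setP/(_ i): uAB.
  by rewrite !finset.inE; case: (i \in A).
by rewrite ffunE eqxx mul1r /ext_coef finset.setUCr eqxx finset.disjoints_subset finset.setCK fintype.subxx.
Qed.

Lemma ext_topP x y : (forall a, ext_top (a * x) = ext_top (a * y)) -> x = y.
Proof.
move=> xy; apply/ffunP => A; have := xy (ext_basis (~: A)%SET).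
rewrite !ext_top_basisM finset.setCK => /(congr1 (fun z => (-1) ^+ inversions (~: A)%SET A * z)).
by rewrite !mulrA -expr2 sqrr_sign !mul1r.
Qed.

Lemma ext_topD x y : ext_top (x + y) = ext_top x + ext_top y.
Proof. by rewrite /ext_top ffunE. Qed.

Lemma ext_topZ (c : K) x : ext_top (c *: x) = c * ext_top x.
Proof. by rewrite /ext_top ffunE. Qed.

(* The pairing (a, b) |-> top coefficient of a b is perfect. *)
Lemma ext_top_repr (lam : E -> K) :
  (forall c x y, lam (c *: x + y) = c * lam x + lam y) ->
  exists b : E, forall a : E, ext_top (a * b) = lam a.
Proof.
move=> lamD.
exists [ffun A : {set 'I_n} => (-1) ^+ inversions (~: A)%SET A * lam (ext_basis (~: A)%SET)].
move=> a; set b := (X in _ * X).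
have lam0 : lam 0 = 0 by move: (lamD (-1) 0 0); rewrite scaler0 addr0 mulN1r addNr.
rewrite (ext_sum_basis a) mulr_suml /=.
have lamA x y : lam (x + y) = lam x + lam y by rewrite -[x in LHS]scale1r lamD mul1r.
rewrite (big_morph lam lamA lam0).
rewrite (big_morph ext_top ext_topD (_ : ext_top 0 = 0)); last by rewrite /ext_top ffunE.
apply: eq_bigr => A _.  rewrite -scalerAl ext_topZ ext_top_basisM.
rewrite /b ffunE finset.setCK [X in _ * X]mulrA -expr2 sqrr_sign mul1r.
by rewrite -[in RHS](addr0 (_ *: _)) lamD lam0 addr0.
Qed.

End ExteriorGenerators.

(** * Modules given by anticommuting operators *)

Lemma mklfun_key (K : fieldType) (V W : vectType K) (f : V -> W) :
  linear f -> {g : 'Hom(V, W) | forall x, g x = f x}.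
Proof.
move=> lf; pose F := GRing.isLinear.Build K V W *:%R f lf.
pose h : {linear V -> W} := HB.pack_for {linear V -> W} f F.
by exists (linfun h) => x; rewrite lfunE.
Qed.

Definition mklfun (K : fieldType) (V W : vectType K) (f : V -> W) (lf : linear f) :
  'Hom(V, W) := sval (mklfun_key lf).

Lemma mklfunE (K : fieldType) (V W : vectType K) (f : V -> W) (lf : linear f) x :
  mklfun lf x = f x.
Proof. exact: (svalP (mklfun_key lf)). Qed.

(* The action of E is recovered from the generators by ext_act below. *)
Record emod (K : fieldType) (n : nat) := EMod {
  emod_car :> vectType K;
  eop : 'I_n -> 'End(emod_car);
  eop_sqr : forall i v, eop i (eop i v) = 0;
  eopC : forall i j v, eop i (eop j v) = - eop j (eop i v)
}.

Section ExtAct.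
Variables (K : fieldType) (n : nat) (V : emod K n).
Local Notation E := (extalg K n).
Implicit Types (A B : {set 'I_n}) (a b : E) (v w : V) (s : seq 'I_n).

Let word s A v := foldr (fun i w => if i \in A then eop V i w else w) v s.

Definition ext_act a v : V := \sum_A a A *: word (enum 'I_n) A v.

Let word_add s i B v : i \notin s -> word s (i |: B)%SET v = word s B v.
Proof.
elim: s => //= k s IH; rewrite inE negb_or finset.in_setU1 eq_sym => /andP[/negPf -> /IH ->].
by [].
Qed.

Let eop_word s i B v : sorted (fun i j : 'I_n => i < j)%N s -> i \in s ->
  eop V i (word s B v) = if i \in B then 0 else
    (-1) ^+ (\sum_(j <- s | j \in B) (j < i))%N *: word s (i |: B)%SET v.
Proof.
elim: s => //= k s IH pks.
have lts : all (fun j : 'I_n => k < j)%N s.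
  by apply: order_path_min pks => x y z; apply: ltn_trans.
have nks : k \notin s by apply/negP => /(allP lts); rewrite ltnn.
rewrite inE => /predU1P[->{i IH}|si].
  rewrite finset.setU11 word_add //; case: ifP => kB; first by rewrite eop_sqr.
  rewrite big_cons kB big_seq_cond big1 ?scale1r // => j /andP[js _].
  by rewrite ltnNge ltnW // (allP lts).
have neki : k == i = false by apply: contraNF nks => /eqP ->.
have ltki : (k < i)%N := allP lts i si.
rewrite finset.in_setU1 neki /= big_cons; case: (boolP (k \in B)) => kB; last first.
  by rewrite IH // (path_sorted pks).
rewrite eopC IH ?(path_sorted pks) //; case: ifP => iB; first by rewrite linear0 oppr0.
by rewrite ltki exprS mulN1r scaleNr linearZ.
Qed.

Let sorted_enum_ord : sorted (fun i j : 'I_n => i < j)%N (enum 'I_n).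
Proof.
have := iota_ltn_sorted 0 n; rewrite -val_enum_ord.
by rewrite sorted_map.
Qed.

Lemma ext_actDl a b v : ext_act (a + b) v = ext_act a v + ext_act b v.
Proof. by rewrite /ext_act -big_split; apply: eq_bigr => A _; rewrite ffunE scalerDl. Qed.

Lemma ext_actZl (c : K) a v : ext_act (c *: a) v = c *: ext_act a v.
Proof. by rewrite /ext_act scaler_sumr; apply: eq_bigr => A _; rewrite ffunE scalerA. Qed.

Lemma ext_act0l v : ext_act 0 v = 0.
Proof. by rewrite -[0 : E](scale0r 0) ext_actZl scale0r. Qed.

Let ext_act_basis A v : ext_act (ext_basis K A) v = word (enum 'I_n) A v.
Proof.
rewrite /ext_act (bigD1 A) //= big1 ?addr0 => [|B nB]; first by rewrite ffunE eqxx scale1r.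
by rewrite ffunE (negPf nB) scale0r.
Qed.

Lemma ext_act_gen i a v : ext_act (ext_gen K i * a) v = eop V i (ext_act a v).
Proof.
rewrite {1}(ext_sum_basis a) mulr_sumr.
rewrite (big_morph (ext_act^~ v) (fun a b => ext_actDl a b v) (ext_act0l v)).
rewrite [ext_act a v]/ext_act linear_sum; apply: eq_bigr => B _.
rewrite -scalerAr ext_actZl linearZ; congr (_ *: _).
rewrite /= eop_word ?mem_enum // ext_genM big_enum_cond /=; case: ifP => _.
  exact: ext_act0l.
by rewrite ext_actZl ext_act_basis.
Qed.

Lemma ext_act1 v : ext_act 1 v = v.
Proof.
rewrite -ext_basis0 ext_act_basis /word; elim: (enum _) => //= i s ->.
by rewrite finset.in_set0.
Qed.

Lemma ext_act_unique (f : E -> V) v : f 1 = v ->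
  (forall c a b, f (c *: a + b) = c *: f a + f b) ->
  (forall i a, f (ext_gen K i * a) = eop V i (f a)) -> forall a, f a = ext_act a v.
Proof.
move=> f1 fD fg; elim/ext_gen_ind => [||c a b IHa IHb|i a IH].
- by rewrite ext_act0l; have := fD (-1) 0 0; rewrite scaler0 addr0 scaleN1r addNr.
- by rewrite f1 ext_act1.
- by rewrite fD IHa IHb ext_actDl ext_actZl.
- by rewrite fg IH ext_act_gen.
Qed.

Lemma ext_actM a b v : ext_act (a * b) v = ext_act a (ext_act b v).
Proof.
elim/ext_gen_ind: a => [||c a a' IH IH'|i a IH].
- by rewrite mul0r !ext_act0l.
- by rewrite mul1r ext_act1.
- by rewrite mulrDl -scalerAl !ext_actDl !ext_actZl IH IH'.
- by rewrite -mulrA !ext_act_gen IH.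
Qed.

Lemma ext_actlinear a : linear (ext_act a).
Proof.
elim/ext_gen_ind: a => [||c a b IHa IHb|i a IH] d v w.
- by rewrite !ext_act0l scaler0 addr0.
- by rewrite !ext_act1.
- rewrite !ext_actDl !ext_actZl IHa IHb !scalerDr !scalerA (mulrC c d) -!addrA.
  by congr (_ + _); rewrite addrCA.
- by rewrite !ext_act_gen IH linearP.
Qed.

Lemma ext_actDr a v w : ext_act a (v + w) = ext_act a v + ext_act a w.
Proof. by have := ext_actlinear a 1 v w; rewrite !scale1r. Qed.

Lemma ext_act0r a : ext_act a 0 = 0.
Proof. by apply: (addIr (ext_act a 0)); rewrite -ext_actDr !add0r. Qed.

Lemma ext_actZr a (c : K) v : ext_act a (c *: v) = c *: ext_act a v.
Proof. by have := ext_actlinear a c v 0; rewrite ext_act0r !addr0. Qed.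

Lemma ext_act_sumr a I (r : seq I) (F : I -> V) :
  ext_act a (\sum_(k <- r) F k) = \sum_(k <- r) ext_act a (F k).
Proof. exact: (big_morph _ (ext_actDr a) (ext_act0r a)). Qed.

Lemma ext_act_suml v I (r : seq I) (F : I -> E) :
  ext_act (\sum_(k <- r) F k) v = \sum_(k <- r) ext_act (F k) v.
Proof. exact: (big_morph (ext_act^~ v) (fun a b => ext_actDl a b v) (ext_act0l v)). Qed.

End ExtAct.

Lemma ext_act_morph (K : fieldType) (n : nat) (V W : emod K n) (f : 'Hom(V, W)) :
  (forall i v, f (eop V i v) = eop W i (f v)) ->
  forall a v, f (ext_act a v) = ext_act a (f v).
Proof.
move=> fg a v; apply: (ext_act_unique (f := fun a => f (ext_act a v))).
- by rewrite ext_act1.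
- by move=> c b b'; rewrite ext_actDl ext_actZl linearP.
- by move=> i b; rewrite ext_act_gen fg.
Qed.

(** * Homology of tensor products with a complex of free right modules *)

Section TensorComplex.
Variables (K : fieldType) (n : nat).
Local Notation E := (extalg K n).
Implicit Types (V W : emod K n).

Definition emorph V W (f : 'Hom(V, W)) := forall i v, f (eop V i v) = eop W i (f v).

Fact tens_subproof V p q (D : 'M[E]_(p, q)) :
  linear (fun y : {ffun 'I_q -> V} => [ffun k => \sum_l ext_act (D k l) (y l)] : {ffun 'I_p -> V}).
Proof.
move=> c x y; apply/ffunP => k; rewrite !ffunE scaler_sumr -big_split.
by apply: eq_bigr => l _; rewrite !ffunE ext_actDr ext_actZr.
Qed.

(* E^q (x)_E V -> E^p (x)_E V, for the right module map E^q -> E^p with matrix D. *)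
Definition tens V p q (D : 'M[E]_(p, q)) := mklfun (@tens_subproof V p q D).

Lemma tensE V p q (D : 'M[E]_(p, q)) (y : {ffun 'I_q -> V}) k :
  tens V D y k = \sum_l ext_act (D k l) (y l).
Proof. by rewrite mklfunE ffunE. Qed.

Lemma tensM V p q r (D : 'M[E]_(p, q)) (D' : 'M[E]_(q, r)) (y : {ffun 'I_r -> V}) :
  tens V D (tens V D' y) = tens V (D *m D') y.
Proof.
apply/ffunP => k; rewrite !tensE.
under eq_bigr => l _ do rewrite tensE ext_act_sumr.
rewrite exchange_big; apply: eq_bigr => l _ /=; rewrite mxE ext_act_suml.
by apply: eq_bigr => i _; rewrite ext_actM.
Qed.

Lemma tens0 V p q (y : {ffun 'I_q -> V}) : tens V (0 : 'M[E]_(p, q)) y = 0.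
Proof.
by apply/ffunP => k; rewrite tensE big1 ?ffunE // => l _; rewrite mxE ext_act0l.
Qed.

Fact ffmap_subproof (V W : vectType K) p (f : 'Hom(V, W)) :
  linear (fun y : {ffun 'I_p -> V} => [ffun k => f (y k)] : {ffun 'I_p -> W}).
Proof. by move=> c x y; apply/ffunP => k; rewrite !ffunE linearP. Qed.

Definition ffmap (V W : vectType K) p (f : 'Hom(V, W)) := mklfun (@ffmap_subproof V W p f).

Lemma ffmapE (V W : vectType K) p (f : 'Hom(V, W)) (y : {ffun 'I_p -> V}) k :
  ffmap p f y k = f (y k).
Proof. by rewrite mklfunE ffunE. Qed.

Lemma ffmap_tens V W (f : 'Hom(V, W)) p q (D : 'M[E]_(p, q)) y : emorph f ->
  ffmap p f (tens V D y) = tens W D (ffmap q f y).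
Proof.
move=> fM; apply/ffunP => k; rewrite ffmapE !tensE linear_sum.
by apply: eq_bigr => l _; rewrite ffmapE /= (ext_act_morph fM).
Qed.

Variables (p q r : nat) (D : 'M[E]_(p, q)) (D' : 'M[E]_(q, r)).
Hypothesis DD' : D *m D' = 0.

(* For consecutive differentials D, D' of a free right resolution of K this is
   dim Tor^E(K, V) in the corresponding degree. *)
Definition tens_homology V := (\dim (lker (tens V D)) - \dim (limg (tens V D')))%N.

Lemma tens_im_sub_ker V : (limg (tens V D') <= lker (tens V D))%VS.
Proof.
by apply/subvP => _ /memv_imgP[y _ ->]; rewrite memv_ker tensM DD' tens0.
Qed.

Lemma tens_homology_retract V W (j : 'Hom(V, W)) (h : 'Hom(W, V)) :
  emorph j -> emorph h -> (forall v, h (j v) = v) ->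
  (tens_homology V <= tens_homology W)%N.
Proof.
move=> jM hM hj.
have HJ s (y : {ffun 'I_s -> V}) : ffmap s h (ffmap s j y) = y.
  by apply/ffunP => k; rewrite !ffmapE hj.
have J0 (U : {vspace {ffun 'I_q -> V}}) : \dim (ffmap q j @: U) = \dim U.
  apply: limg_dim_eq; apply/eqP; rewrite -subv0; apply/subvP => y.
  rewrite memv_cap memv_ker memv0 => /andP[_ /eqP y0].
  by rewrite -(HJ _ y) y0 linear0.
set J := ffmap q j.
have sub1 : (J @: lker (tens V D) + limg (tens W D') <= lker (tens W D))%VS.
  rewrite subv_add tens_im_sub_ker andbT.
  apply/subvP => _ /memv_imgP[y + ->]; rewrite !memv_ker -ffmap_tens // => /eqP ->.
  by rewrite linear0.
have sub2 : (J @: lker (tens V D) :&: limg (tens W D') <= J @: limg (tens V D'))%VS.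
  apply/subvP => x; rewrite memv_cap => /andP[/memv_imgP[y _ ->] /memv_imgP[w _ e]].
  apply: memv_img; rewrite -(HJ _ y) e ffmap_tens //.
  by apply: memv_img; apply: memvf.
have arith (s c kV iW iV kW : nat) :
  (s + c = kV + iW -> c <= iV -> s <= kW -> kV - iV <= kW - iW)%N by lia.
have eqd := dimv_sum_cap (J @: lker (tens V D)) (limg (tens W D')).
have := dimvS sub2; rewrite !J0 in eqd * => le2.
exact: arith eqd le2 (dimvS sub1).
Qed.

Lemma tens_homology_ses (V1 V2 V3 : emod K n) (j : 'Hom(V1, V2)) (h : 'Hom(V2, V3)) :
  emorph j -> emorph h -> lker j = 0%VS -> limg h = fullv -> lker h = limg j ->
  (tens_homology V2 <= tens_homology V1 + tens_homology V3)%N.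
Proof.
move=> jM hM j0 hT jh.
have Jinj s (y : {ffun 'I_s -> V1}) : ffmap s j y = 0 -> y = 0.
  move=> y0; apply/ffunP => k; rewrite ffunE; apply/eqP; rewrite -memv0 -j0 memv_ker.
  by rewrite -ffmapE y0 ffunE.
have J0 s (U : {vspace {ffun 'I_s -> V1}}) : \dim (ffmap s j @: U) = \dim U.
  apply: limg_dim_eq; apply/eqP; rewrite -subv0; apply/subvP => y.
  by rewrite memv_cap memv_ker memv0 => /andP[_ /eqP/Jinj ->].
have HJ s (y : {ffun 'I_s -> V1}) : ffmap s h (ffmap s j y) = 0.
  apply/ffunP => k; rewrite !ffmapE ffunE; apply/eqP; rewrite -memv_ker jh.
  by apply: memv_img; apply: memvf.
have kerH s (y : {ffun 'I_s -> V2}) : ffmap s h y = 0 -> exists x, y = ffmap s j x.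
  move=> y0; exists (ffmap s j^-1%VF y); apply/ffunP => k; rewrite !ffmapE limg_lfunVK //.
  by rewrite -jh memv_ker -ffmapE y0 ffunE.
have Hsurj s (y : {ffun 'I_s -> V3}) : exists x, y = ffmap s h x.
  exists (ffmap s h^-1%VF y); apply/ffunP => k; rewrite !ffmapE limg_lfunVK //.
  by rewrite hT memvf.
have ker_le : (\dim (lker (tens V2 D)) <= \dim (lker (tens V1 D)) + \dim (lker (tens V3 D)))%N.
  rewrite -(limg_ker_dim (ffmap q h)) -(J0 q (lker (tens V1 D))); apply: leq_add; apply: dimvS.
    apply/subvP => y; rewrite memv_cap !memv_ker => /andP[/eqP y0 /eqP/kerH[x ex]].
    rewrite {}ex in y0 *; apply: memv_img; rewrite memv_ker.
    by rewrite -ffmap_tens // in y0; rewrite (Jinj _ _ y0).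
  apply/subvP => _ /memv_imgP[y + ->]; rewrite !memv_ker -ffmap_tens // => /eqP ->.
  by rewrite linear0.
have im_ge : (\dim (limg (tens V1 D')) + \dim (limg (tens V3 D')) <= \dim (limg (tens V2 D')))%N.
  rewrite -(limg_ker_dim (ffmap q h)) -(J0 q (limg (tens V1 D'))); apply: leq_add; apply: dimvS.
    apply/subvP => _ /memv_imgP[_ /memv_imgP[y _ ->] ->].
    rewrite memv_cap memv_ker HJ eqxx andbT ffmap_tens //.
    by apply: memv_img; apply: memvf.
  apply/subvP => _ /memv_imgP[y _ ->]; have [x ->] := Hsurj _ y.
  by rewrite -ffmap_tens //; do 2!apply: memv_img; apply: memvf.
have arith (k1 k2 k3 i1 i2 i3 : nat) : (k2 <= k1 + k3 -> i1 + i3 <= i2 ->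
  i1 <= k1 -> i3 <= k3 -> k2 - i2 <= (k1 - i1) + (k3 - i3))%N by lia.
exact: arith ker_le im_ge (dimvS (tens_im_sub_ker V1)) (dimvS (tens_im_sub_ker V3)).
Qed.

End TensorComplex.

Section Triangular.
Variables (K : fieldType) (n : nat) (V : emod K n) (sg : 'End(V)).
Hypothesis sgK : forall v, sg (sg v) = v.
Hypothesis sgX : forall i v, sg (eop V i v) = - eop V i (sg v).
Variables (p q r : nat) (D : 'M[extalg K n]_(p, q)) (D' : 'M[extalg K n]_(q, r)).
Hypothesis DD' : D *m D' = 0.

Fact etwist_sqr (e : nat) i v :
  ((-1) ^+ e *: eop V i)%VF (((-1) ^+ e *: eop V i)%VF v) = 0.
Proof. by rewrite !scale_lfunE linearZ /= eop_sqr !scaler0. Qed.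

Fact etwistC (e : nat) i j v :
  ((-1) ^+ e *: eop V i)%VF (((-1) ^+ e *: eop V j)%VF v) =
  - ((-1) ^+ e *: eop V j)%VF (((-1) ^+ e *: eop V i)%VF v).
Proof. by rewrite !scale_lfunE !linearZ /= eopC !scalerN. Qed.

Definition etwist (e : nat) : emod K n := EMod (etwist_sqr e) (etwistC e).

Lemma tens_homology_twist e : (tens_homology D D' (etwist e) <= tens_homology D D' V)%N.
Proof.
pose j : 'Hom(V, V) := if odd e then sg else \1%VF.
have jj v : j (j v) = v by rewrite /j; case: odd; rewrite ?sgK ?lfunE.
have je v : (-1) ^+ e *: v = if odd e then - v else v.
  by rewrite -signr_odd; case: odd; rewrite ?expr1 ?scaleN1r ?expr0 ?scale1r.
have jX i v : j (eop V i v) = (-1) ^+ e *: eop V i (j v).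
  by rewrite je /j; case: odd; rewrite ?sgX ?lfunE.
apply: (@tens_homology_retract _ _ _ _ _ _ _ DD' (etwist e) V j j) => // i v; rewrite ?jX /=.
  by rewrite scale_lfunE linearZ /= jX scalerA -expr2 sqrr_sign scale1r.
by rewrite scale_lfunE.
Qed.

(* V^N is filtered by increasing h, with subquotients V up to the sign of the
   action. *)
Lemma tens_homology_triangular N (W : emod K n) (f : 'Hom(W, {ffun 'I_N -> V}))
    (g : 'Hom({ffun 'I_N -> V}, W)) (fK : cancel f g) (gK : cancel g f)
    (h : 'I_N -> int) (e : 'I_N -> nat) :
  (forall i k w, (forall l, h l < h k -> f w l = 0) ->
    f (eop W i w) k = (-1) ^+ e k *: eop V i (f w k)) ->
  (tens_homology D D' W <= N * tens_homology D D' V)%N.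
Proof.
elim: N W f g fK gK h e => [|N IH] W f g fK gK h e tri.
  rewrite mul0n leqn0 subn_eq0 (_ : lker _ = 0%VS) ?dimv0 //.
  apply/eqP; rewrite -subv0; apply/subvP => y _; rewrite memv0; apply/eqP/ffunP => k.
  by rewrite ffunE -[LHS]fK (_ : f (y k) = 0) ?linear0 //; apply/ffunP => -[].
pose k0 := [arg min_(k < ord0) h k]%O.
have k0P k : (h k < h k0) = false.
  by rewrite /k0; case: arg_minP => // k1 _ /(_ k isT); rewrite ltNge => ->.
have jL : linear (fun w : {ffun 'I_N -> V} =>
    g [ffun k => if unlift k0 k is Some l then w l else 0]).
  move=> c x y; rewrite -linearP; congr (g _); apply/ffunP => k; rewrite !ffunE.
  by case: unliftP => [l|] _; rewrite ?ffunE // scaler0 addr0.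
have dL : linear (fun w : W => [ffun l => f w (lift k0 l)] : {ffun 'I_N -> V}).
  by move=> c x y; apply/ffunP => l; rewrite linearP !ffunE.
pose j := mklfun jL; pose d := mklfun dL.
have dj w : d (j w) = w.
  by apply/ffunP => l; rewrite !mklfunE ffunE gK ffunE liftK.
have fj0 w : f (j w) k0 = 0 by rewrite mklfunE gK ffunE unlift_none.
have jd w : f w k0 = 0 -> j (d w) = w.
  move=> w0; apply: (can_inj fK); apply/ffunP => k; rewrite !mklfunE gK ffunE.
  by case: unliftP => [l ->|->]; rewrite ?ffunE ?w0.
have fX0 i w : f (eop W i w) k0 = (-1) ^+ e k0 *: eop V i (f w k0).
  by apply: tri => l; rewrite k0P.
have Xj i w : f (eop W i (j w)) k0 = 0 by rewrite fX0 fj0 linear0 scaler0.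
pose X i : 'End({ffun 'I_N -> V}) := (d \o eop W i \o j)%VF.
have XE i w : X i w = d (eop W i (j w)) by rewrite !lfunE /= !lfunE.
have Xsqr i w : X i (X i w) = 0 by rewrite !XE jd // eop_sqr linear0.
have XC i i' w : X i (X i' w) = - X i' (X i w).
  by rewrite !XE !jd // eopC linearN.
pose W1 := EMod Xsqr XC.
have evL : linear (fun w : W => f w k0) by move=> c x y; rewrite linearP !ffunE.
rewrite mulSn addnC.
apply: (leq_trans (@tens_homology_ses _ _ _ _ _ D D' DD' W1 W (etwist (e k0)) j (mklfun evL) _ _ _ _ _)).
- by move=> i w /=; rewrite XE jd.
- by move=> i w /=; rewrite !mklfunE fX0 scale_lfunE.
- apply/eqP; rewrite -subv0; apply/subvP => w; rewrite memv_ker memv0 => /eqP w0.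
  by rewrite -(dj w) w0 linear0.
- apply/vspaceP => v; rewrite memvf; apply/memv_imgP.
  by exists (g [ffun => v]); rewrite ?memvf // mklfunE gK ffunE.
- apply/vspaceP => w; rewrite memv_ker mklfunE; apply/eqP/memv_imgP => [w0|[x _ ->]] //.
  by exists (d w); rewrite ?memvf // jd.
apply: leq_add; last exact: tens_homology_twist.
have idL : linear (fun w : W1 => w : {ffun 'I_N -> V}) by [].
have idL' : linear (fun w : {ffun 'I_N -> V} => w : W1) by [].
apply: (IH W1 (mklfun idL) (mklfun idL') _ _ (h \o lift k0) (e \o lift k0)).
- by move=> w; rewrite !mklfunE.
- by move=> w; rewrite !mklfunE.
move=> i l w wl; rewrite !mklfunE /= XE mklfunE ffunE tri.
  by rewrite mklfunE gK ffunE liftK.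
move=> l' hl'; rewrite mklfunE gK ffunE; case: unliftP => // l'' el.
by have := wl l''; rewrite mklfunE /= -el; apply.
Qed.

End Triangular.

(** * Graded matrix representations, duals and tensor products *)

(* Row vectors in a homogeneous basis; e_i acts by u |-> u *m grep_op i. *)
Record grep (K : fieldType) (n : nat) := GRep {
  grep_dim : nat;
  grep_deg : 'I_grep_dim -> int;
  grep_op : 'I_n -> 'M[K]_grep_dim;
  grep_op_deg : forall i k l, grep_op i k l != 0 -> grep_deg l = grep_deg k + 1;
  grep_op_sqr : forall i, grep_op i *m grep_op i = 0;
  grep_opC : forall i j, grep_op i *m grep_op j = - (grep_op j *m grep_op i)
}.

Section GRep.
Variables (K : fieldType) (n : nat).
Implicit Types (g : grep K n).

Definition grep_sign g : 'rV[K]_(grep_dim g) := \row_k (-1) ^+ absz (grep_deg k).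
Definition grep_par g : 'M[K]_(grep_dim g) := diag_mx (grep_sign g).

Lemma grep_parK g : grep_par g *m grep_par g = 1%:M.
Proof.
apply/matrixP => k l; rewrite mul_diag_mx !mxE; case: eqP => [->|_]; last by rewrite mulr0n mulr0.
by rewrite !mulr1n -expr2 sqrr_sign.
Qed.

Lemma tr_grep_par g : (grep_par g)^T = grep_par g.
Proof. exact: tr_diag_mx. Qed.

Lemma grep_op_sign g i k l :
  grep_op g i k l * grep_sign g 0 l = - (grep_sign g 0 k * grep_op g i k l).
Proof.
have [->|/grep_op_deg e] := eqVneq (grep_op g i k l) 0; first by rewrite mul0r mulr0 oppr0.
by rewrite !mxE e signr_abszD expr1 mulrN1 mulrN mulrC.
Qed.

Lemma grep_op_signl g i k l :
  grep_op g i k l * grep_sign g 0 k = - (grep_sign g 0 l * grep_op g i k l).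
Proof. by rewrite mulrC -[LHS]opprK -grep_op_sign mulrC. Qed.

Lemma grep_op_par g i : grep_op g i *m grep_par g = - (grep_par g *m grep_op g i).
Proof.
apply/matrixP => k l; rewrite mul_mx_diag mul_diag_mx [LHS]mxE [RHS]mxE.
by rewrite [X in - X]mxE grep_op_sign.
Qed.

Definition grep_emod_op g i : 'End('rV[K]_(grep_dim g)) := linfun (mulmxr (grep_op g i)).

Lemma grep_emod_opE g i u : grep_emod_op g i u = u *m grep_op g i.
Proof. by rewrite lfunE. Qed.

Fact grep_emod_sqr g i u : grep_emod_op g i (grep_emod_op g i u) = 0.
Proof. by rewrite !grep_emod_opE -mulmxA grep_op_sqr mulmx0. Qed.

Fact grep_emodC g i j u :
  grep_emod_op g i (grep_emod_op g j u) = - grep_emod_op g j (grep_emod_op g i u).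
Proof. by rewrite !grep_emod_opE -!mulmxA grep_opC mulmxN. Qed.

Definition grep_emod g : emod K n := EMod (@grep_emod_sqr g) (@grep_emodC g).

(* (e_i f)(m) = f(m e_i) and m e_i = e_i (-1)^(deg m) m. *)
Definition dual_op g i : 'M[K]_(grep_dim g) := (grep_op g i)^T *m grep_par g.

Lemma dual_opE g i k l : dual_op g i k l = grep_op g i l k * grep_sign g 0 l.
Proof. by rewrite /dual_op /grep_par mul_mx_diag !mxE. Qed.

Fact dual_op_deg g i k l : dual_op g i k l != 0 -> - @grep_deg _ _ g l = - grep_deg k + 1.
Proof.
rewrite dual_opE mulf_eq0 negb_or => /andP[/grep_op_deg -> _].
by rewrite opprD addrK.
Qed.

Lemma dual_opM g i j :
  dual_op g i *m dual_op g j = - (grep_op g j *m grep_op g i)^T.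
Proof.
rewrite /dual_op mulmxA -(mulmxA _ (grep_par g)) -[in X in _ *m (X *m _)]tr_grep_par -trmx_mul.
rewrite grep_op_par linearN /= trmx_mul tr_grep_par mulmxN mulNmx.
by rewrite -!mulmxA grep_parK mulmx1 -trmx_mul.
Qed.

Fact dual_op_sqr g i : dual_op g i *m dual_op g i = 0.
Proof. by rewrite dual_opM grep_op_sqr trmx0 oppr0. Qed.

Fact dual_opC g i j : dual_op g i *m dual_op g j = - (dual_op g j *m dual_op g i).
Proof. by rewrite !dual_opM grep_opC linearN. Qed.

Definition grep_dual g : grep K n := GRep (@dual_op_deg g) (@dual_op_sqr g) (@dual_opC g).

Lemma grep_sign_dual g : grep_sign (grep_dual g) = grep_sign g.
Proof. by apply/rowP => k; rewrite !mxE /= abszN. Qed.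

Lemma grep_op_bidual g i :
  grep_op (grep_dual (grep_dual g)) i = - grep_op g i.
Proof.
rewrite /= /dual_op /= /grep_par grep_sign_dual -/(grep_par g) /dual_op trmx_mul trmxK.
by rewrite tr_grep_par -mulmxA grep_op_par mulmxN mulmxA grep_parK mul1mx.
Qed.

Section Tensor.
Variables (g : grep K n) (V : emod K n) (sg : 'End(V)).
Local Notation q := (grep_dim g).
Local Notation B := (grep_op g).
Local Notation s := (grep_sign g 0).
Hypothesis sgK : forall v, sg (sg v) = v.
Hypothesis sgX : forall i v, sg (eop V i v) = - eop V i (sg v).

(* V (x) g, with e (x (x) y) = e x (x) y + (-1)^(deg x) x (x) e y. *)
Fact tensr_subproof i : linear (fun w : {ffun 'I_q -> V} =>
  [ffun j => eop V i (w j) + \sum_l B i l j *: sg (w l)] : {ffun 'I_q -> V}).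
Proof.
move=> c x y; apply/ffunP => k; rewrite !ffunE linearP.
under eq_bigr => l _ do rewrite !ffunE linearP scalerDr scalerA mulrC -scalerA.
by rewrite big_split -scaler_sumr /= addrACA scalerDr.
Qed.

Definition tensr_op i := mklfun (tensr_subproof i).

Lemma tensr_opE i w j : tensr_op i w j = eop V i (w j) + \sum_l B i l j *: sg (w l).
Proof. by rewrite mklfunE ffunE. Qed.

Lemma tensr_op2 a b w j : tensr_op a (tensr_op b w) j =
  eop V a (eop V b (w j)) +
  (\sum_l B b l j *: eop V a (sg (w l)) - \sum_l B a l j *: eop V b (sg (w l))) +
  \sum_l (B b *m B a) l j *: w l.
Proof.
rewrite !tensr_opE linearD /= linear_sum -!addrA; congr (_ + (_ + _)).
  by apply: eq_bigr => l _; rewrite linearZ.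
under eq_bigr => l _ do rewrite tensr_opE linearD /= sgX linear_sum scalerDr scalerN.
rewrite big_split sumrN /=; congr (_ + _).
under [RHS]eq_bigr => l _ do rewrite mxE scaler_suml.
rewrite exchange_big; apply: eq_bigr => k _ /=; rewrite scaler_sumr; apply: eq_bigr => l _.
by rewrite linearZ /= sgK scalerA mulrC.
Qed.

Fact tensr_op_sqr i w : tensr_op i (tensr_op i w) = 0.
Proof.
apply/ffunP => j; rewrite tensr_op2 eop_sqr subrr grep_op_sqr ffunE !add0r.
by rewrite big1 // => l _; rewrite mxE scale0r.
Qed.

Fact tensr_opC a b w : tensr_op a (tensr_op b w) = - tensr_op b (tensr_op a w).
Proof.
apply/ffunP => j; rewrite [RHS]ffunE !tensr_op2 opprD [X in _ = X - _]opprD opprB eopC grep_opC.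
congr (_ + _ + _).
by rewrite -sumrN; apply: eq_bigr => l _; rewrite mxE scaleNr.
Qed.

Definition tensr : emod K n := EMod tensr_op_sqr tensr_opC.

(* g (x) V, with the same rule. *)
Fact tensl_subproof i : linear (fun w : {ffun 'I_q -> V} =>
  [ffun k => s k *: eop V i (w k) + \sum_l B i l k *: w l] : {ffun 'I_q -> V}).
Proof.
move=> c x y; apply/ffunP => k; rewrite !ffunE linearP.
under eq_bigr => l _ do rewrite !ffunE scalerDr scalerA mulrC -scalerA.
rewrite big_split -scaler_sumr /= !scalerDr [RHS]addrACA; congr (_ + _ + _).
by rewrite !scalerA mulrC.
Qed.

Definition tensl_op i := mklfun (tensl_subproof i).

Lemma tensl_opE i w k : tensl_op i w k = s k *: eop V i (w k) + \sum_l B i l k *: w l.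
Proof. by rewrite mklfunE ffunE. Qed.

Lemma tensl_op2 a b w k : tensl_op a (tensl_op b w) k =
  eop V a (eop V b (w k)) +
  s k *: (\sum_l B b l k *: eop V a (w l) - \sum_l B a l k *: eop V b (w l)) +
  \sum_l (B b *m B a) l k *: w l.
Proof.
have ss : s k * s k = 1 by rewrite mxE -expr2 sqrr_sign.
rewrite !tensl_opE linearD /= linear_sum linearZ scalerDr scalerA ss scale1r -!addrA; congr (_ + _).
rewrite scalerBr -addrA; congr (_ + _).
  by congr (_ *: _); apply: eq_bigr => l _; rewrite linearZ.
under eq_bigr => l _ do rewrite tensl_opE scalerDr scalerA grep_op_signl scaleNr -scalerA.
rewrite big_split sumrN scaler_sumr /=; congr (_ + _).
under [RHS]eq_bigr => l _ do rewrite mxE scaler_suml.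
rewrite exchange_big; apply: eq_bigr => l _ /=; rewrite scaler_sumr; apply: eq_bigr => i _.
by rewrite scalerA mulrC.
Qed.

Fact tensl_op_sqr i w : tensl_op i (tensl_op i w) = 0.
Proof.
apply/ffunP => j; rewrite tensl_op2 eop_sqr subrr grep_op_sqr ffunE scaler0 !add0r.
by rewrite big1 // => l _; rewrite mxE scale0r.
Qed.

Fact tensl_opC a b w : tensl_op a (tensl_op b w) = - tensl_op b (tensl_op a w).
Proof.
apply/ffunP => j; rewrite [RHS]ffunE !tensl_op2 opprD [X in _ = X - _]opprD -scalerN opprB eopC grep_opC.
congr (_ + _ + _).
by rewrite -sumrN; apply: eq_bigr => l _; rewrite mxE scaleNr.
Qed.

Definition tensl : emod K n := EMod tensl_op_sqr tensl_opC.

Variables (c d r : nat) (D : 'M[extalg K n]_(c, d)) (D' : 'M[extalg K n]_(d, r)).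
Hypothesis DD' : D *m D' = 0.

Let triang i k (F : 'I_q -> V) : (forall l, grep_deg l < grep_deg k -> F l = 0) ->
  \sum_l B i l k *: F l = 0.
Proof.
move=> F0; rewrite big1 // => l _.
have [->|/grep_op_deg e] := eqVneq (B i l k) 0; first by rewrite scale0r.
by rewrite F0 ?scaler0 // e ltrDl.
Qed.

Lemma tens_homology_tensr : (tens_homology D D' tensr <= q * tens_homology D D' V)%N.
Proof.
have idL : linear (fun w : tensr => w : {ffun 'I_q -> V}) by [].
have idL' : linear (fun w : {ffun 'I_q -> V} => w : tensr) by [].
apply: (@tens_homology_triangular _ _ V sg sgK sgX _ _ _ _ _ DD' q tensr (mklfun idL) (mklfun idL')
  _ _ (@grep_deg _ _ g) (fun=> 0%N)) => [w|w|i k w w0]; rewrite ?(mklfunE idL) ?(mklfunE idL') //=.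
rewrite tensr_opE triang ?addr0 ?scale1r // => l /w0.
by rewrite (mklfunE idL) => ->; rewrite linear0.
Qed.

Lemma tens_homology_tensl : (tens_homology D D' tensl <= q * tens_homology D D' V)%N.
Proof.
have idL : linear (fun w : tensl => w : {ffun 'I_q -> V}) by [].
have idL' : linear (fun w : {ffun 'I_q -> V} => w : tensl) by [].
apply: (@tens_homology_triangular _ _ V sg sgK sgX _ _ _ _ _ DD' q tensl (mklfun idL) (mklfun idL')
  _ _ (@grep_deg _ _ g) (fun k => absz (grep_deg k))) => [w|w|i k w w0]; rewrite ?(mklfunE idL) ?(mklfunE idL') //=.
rewrite tensl_opE triang ?addr0 ?mxE // => l /w0.
by rewrite (mklfunE idL) => ->.
Qed.

End Tensor.
End GRep.

Section DualHomology.
Variables (K : fieldType) (n : nat).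
Implicit Types (g : grep K n).

Definition grep_sg g : 'End(grep_emod g) := linfun (mulmxr (grep_par g)).

Lemma grep_sgE g u : grep_sg g u = u *m grep_par g.
Proof. by rewrite lfunE. Qed.

Lemma grep_sgK g u : grep_sg g (grep_sg g u) = u.
Proof. by rewrite !grep_sgE -mulmxA grep_parK mulmx1. Qed.

Lemma grep_sgX g i u : grep_sg g (eop (grep_emod g) i u) = - eop (grep_emod g) i (grep_sg g u).
Proof. by rewrite /= !grep_emod_opE !grep_sgE -!mulmxA grep_op_par mulmxN. Qed.

Section TensorSign.
Variables (g : grep K n) (V : emod K n) (sg : 'End(V)).
Hypothesis sgK : forall v, sg (sg v) = v.
Hypothesis sgX : forall i v, sg (eop V i v) = - eop V i (sg v).
Local Notation q := (grep_dim g).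
Local Notation s := (grep_sign g 0).

Fact tensr_sg_subproof : linear (fun w : {ffun 'I_q -> V} =>
  [ffun j => s j *: sg (w j)] : {ffun 'I_q -> V}).
Proof.
move=> c x y; apply/ffunP => j; rewrite !ffunE linearP scalerDr; congr (_ + _).
by rewrite !scalerA mulrC.
Qed.

Definition tensr_sg := mklfun tensr_sg_subproof.

Lemma tensr_sgE w j : tensr_sg w j = s j *: sg (w j).
Proof. by rewrite mklfunE ffunE. Qed.

Lemma tensr_sgK w : tensr_sg (tensr_sg w) = w.
Proof.
apply/ffunP => j; rewrite !tensr_sgE linearZ /= sgK scalerA mxE -expr2.
by rewrite sqrr_sign scale1r.
Qed.

Lemma tensr_sgX i w :
  tensr_sg (tensr_op g sg i w) = - tensr_op g sg i (tensr_sg w).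
Proof.
apply/ffunP => j; rewrite [RHS]ffunE !tensr_sgE !tensr_opE tensr_sgE !linearD /=.
congr (_ + _); first by rewrite sgX linearZ /= scalerN.
rewrite linear_sum scaler_sumr -sumrN; apply: eq_bigr => l _.
rewrite tensr_sgE !linearZ /= !scalerA scalerN -scaleNr; congr (_ *: _).
by rewrite grep_op_sign mulrC.
Qed.

End TensorSign.

Variable g : grep K n.
Local Notation m := (grep_dim g).
Local Notation A := (grep_op g).
Local Notation s := (grep_sign g 0).
Local Notation VV := (tensr (grep_dual g) (@grep_sgK g) (@grep_sgX g)).
Local Notation W := (tensl (grep_dual g) VV).

(* psi |-> psi (x) sum_j x_j (x) x_j^* *)
Fact coev_subproof : linear (fun psi : grep_emod (grep_dual g) =>
  [ffun k => [ffun j => psi 0 k *: delta_mx 0 j]] : W).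
Proof.
move=> c x y; apply/ffunP => k; apply/ffunP => j.
by rewrite !ffunE !mxE scalerDl scalerA.
Qed.

(* psi (x) u (x) chi |-> <psi, u> chi *)
Fact ev_subproof : linear (fun w : W =>
  (\row_j \sum_k (w k j : 'rV_m) 0 k) : grep_emod (grep_dual g)).
Proof.
move=> c x y; apply/rowP => j; rewrite !mxE mulr_sumr -big_split.
by apply: eq_bigr => k _; rewrite !ffunE !mxE.
Qed.

Lemma tensr_coev i (c : K) : tensr_op (grep_dual g) (grep_sg g) i
  ([ffun j => c *: delta_mx 0 j] : {ffun 'I_m -> grep_emod g}) = 0.
Proof.
apply/ffunP => j; rewrite tensr_opE !ffunE linearZ /= grep_emod_opE.
under eq_bigr => l _ do rewrite ffunE linearZ /= grep_sgE scalerA mulrC -scalerA.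
rewrite -scaler_sumr -scalerDr; apply/eqP; rewrite scaler_eq0; apply/orP; right; apply/eqP.
apply/rowP => l; rewrite -rowE mxE summxE (bigD1 l) //= big1 ?addr0.
  rewrite !(mxE scalemx_key) dual_opE -rowE !mxE eqxx mulr1n.
  have := @grep_op_sign K n g i j l; rewrite !mxE => e.
  by rewrite mulrAC e mulNr mulrAC -expr2 sqrr_sign mul1r; exact: subrr.
move=> l' nl'; rewrite !(mxE scalemx_key) -rowE !mxE (negPf nl') mulr0n mulr0 //.
Qed.

Lemma grep_coev_morph : emorph (mklfun coev_subproof).
Proof.
move=> i psi; rewrite !(mklfunE coev_subproof); apply/ffunP => k; rewrite ffunE [RHS]tensl_opE /=.
rewrite ffunE tensr_coev scaler0 add0r; apply/ffunP => j; rewrite ffunE sum_ffunE.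
rewrite (grep_emod_opE (g := grep_dual g)) mxE scaler_suml; apply: eq_bigr => l _.
by rewrite !ffunE scalerA mulrC.
Qed.

Lemma tensl_tensr_opE i (w : W) k j : (eop W i w k : {ffun 'I_m -> 'rV[K]_m}) j =
  s k *: (w k j *m A i + \sum_l dual_op g i l j *: (w k l *m grep_par g)) +
  \sum_l dual_op g i l k *: w l j.
Proof.
rewrite [eop W i w k]tensl_opE ffunE sum_ffunE ffunE [X in _ *: X]tensr_opE grep_sign_dual.
congr (_ *: (_ + _) + _); first exact: grep_emod_opE.
  by apply: eq_bigr => l _; congr (_ *: _); apply: grep_sgE.
by apply: eq_bigr => l _; rewrite ffunE.
Qed.

Lemma grep_ev_morph : emorph (mklfun ev_subproof).
Proof.
move=> i w; rewrite !(mklfunE ev_subproof); apply/rowP => j; rewrite mxE.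
have opE (u : 'rV_m) : u *m dual_op g i = eop (grep_emod (grep_dual g)) i u.
  by rewrite -(grep_emod_opE (g := grep_dual g)).
rewrite -opE mxE.
transitivity (\sum_k (s k * (w k j *m A i) 0 k + s k * (\sum_l dual_op g i l j * (s k * w k l 0 k))
   + \sum_l dual_op g i l k * w l j 0 k)).
  apply: eq_bigr => k _; rewrite tensl_tensr_opE !mxE !summxE mulrDr.
  congr (_ + _ * _ + _).
    apply: eq_bigr => l _; rewrite mxE; congr (_ * _).
    by rewrite mul_mx_diag !mxE mulrC.
  by apply: eq_bigr => l _; rewrite mxE.
rewrite !big_split /= addrAC [X in X + _ = _](_ : _ = 0) ?add0r.
  under eq_bigr => k _ do rewrite mulr_sumr.
  rewrite exchange_big; apply: eq_bigr => l _ /=; rewrite mxE mulr_suml.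
  apply: eq_bigr => k _.
  have ss : s k * s k = 1 by rewrite mxE -expr2 sqrr_sign.
  by rewrite -[RHS]mul1r -ss; ring.
under eq_bigr => k _ do rewrite [X in s k * X]mxE mulr_sumr.
rewrite [X in _ + X]exchange_big /= -big_split big1 // => k _ /=.
rewrite -big_split big1 // => l _ /=.
by rewrite dual_opE grep_op_signl; ring.
Qed.

Variables (c d r : nat) (D : 'M[extalg K n]_(c, d)) (D' : 'M[extalg K n]_(d, r)).
Hypothesis DD' : D *m D' = 0.

(* By coev and ev, M^* is a retract of M^* (x) M (x) M^*. *)
Lemma tens_homology_dual_le :
  (tens_homology D D' (grep_emod (grep_dual g)) <= m * (m * tens_homology D D' (grep_emod g)))%N.
Proof.
have le1 := tens_homology_tensr (grep_dual g) (@grep_sgK g) (@grep_sgX g) DD'.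
have le2 := tens_homology_tensl (grep_dual g) (V := VV) (sg := tensr_sg (grep_dual g) (grep_sg g))
  (tensr_sgK (@grep_sgK g)) (tensr_sgX (@grep_sgX g)) DD'.
apply: leq_trans (leq_trans le2 _); last by rewrite leq_mul2l le1 orbT.
apply: (tens_homology_retract DD' grep_coev_morph grep_ev_morph) => psi.
rewrite (mklfunE ev_subproof) (mklfunE coev_subproof); apply/rowP => j; rewrite mxE.
rewrite (bigD1 j) //= big1 ?addr0 => [|k nk].
  by rewrite !ffunE !mxE !eqxx mulr1.
by rewrite !ffunE !mxE (negPf nk) andbF mulr0.
Qed.

End DualHomology.

Lemma tens_homology_bidual (K : fieldType) (n : nat) (g : grep K n) (c d r : nat)
    (D : 'M[extalg K n]_(c, d)) (D' : 'M[extalg K n]_(d, r)) : D *m D' = 0 ->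
  (tens_homology D D' (grep_emod g) <=
   tens_homology D D' (grep_emod (grep_dual (grep_dual g))))%N.
Proof.
move=> DD'; pose g2 := grep_dual (grep_dual g).
have bd i (u : 'rV_(grep_dim g)) : u *m grep_op g2 i = - (u *m grep_op g i).
  by rewrite grep_op_bidual mulmxN.
pose j : 'Hom(grep_emod g, grep_emod g2) := linfun (mulmxr (grep_par g)).
pose j' : 'Hom(grep_emod g2, grep_emod g) := linfun (mulmxr (grep_par g)).
apply: (@tens_homology_retract _ _ _ _ _ _ _ DD' (grep_emod g) (grep_emod g2) j j').
- move=> i u; rewrite !lfunE /=.
  by rewrite bd -!mulmxA grep_op_par mulmxN.
- move=> i u; rewrite !lfunE /=.
  by rewrite bd mulNmx -!mulmxA grep_op_par mulmxN opprK.
- by move=> u; rewrite !lfunE /= -mulmxA grep_parK mulmx1.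
Qed.

(** * Matrix representations of graded modules and of their duals *)

Record grep_iso (K : fieldType) (n : nat) (M : gmod K n) (g : grep K n) := GRepIso {
  grep_fun :> 'rV[K]_(grep_dim g) -> M;
  grep_fun_linear : forall c u v, grep_fun (c *: u + v) = (c%:A : extalg K n) *: grep_fun u + grep_fun v;
  grep_fun_inj : injective grep_fun;
  grep_fun_surj : forall m, exists u, m = grep_fun u;
  grep_fun_op : forall i u, grep_fun (u *m grep_op g i) = ext_gen K i *: grep_fun u
}.

Section GRepIso.
Variables (K : fieldType) (n : nat) (M : gmod K n) (g : grep K n) (phi : grep_iso M g).

Lemma grep_fun0 : phi 0 = 0.
Proof.
have := grep_fun_linear phi (-1) 0 0.
by rewrite scaler0 addr0 scaleN1r scaleN1r addNr.
Qed.

Lemma grep_funD u v : phi (u + v) = phi u + phi v.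
Proof. by rewrite -[u in LHS]scale1r grep_fun_linear !scale1r. Qed.

Lemma grep_funZ c u : phi (c *: u) = (c%:A : extalg K n) *: phi u.
Proof. by rewrite -[_ *: u in LHS]addr0 grep_fun_linear grep_fun0 addr0. Qed.

Lemma grep_funB u v : phi (u - v) = phi u - phi v.
Proof. by rewrite -[- v]scaleN1r grep_funD grep_funZ !scaleN1r. Qed.

Lemma grep_fun_sum I (r : seq I) (F : I -> 'rV_(grep_dim g)) :
  phi (\sum_(k <- r) F k) = \sum_(k <- r) phi (F k).
Proof. exact: (big_morph phi grep_funD grep_fun0). Qed.

Lemma grep_fun_delta u : phi u = \sum_k ((u 0 k)%:A : extalg K n) *: phi (delta_mx 0 k).
Proof. by rewrite {1}[u]row_sum_delta grep_fun_sum; apply: eq_bigr => k _; rewrite grep_funZ. Qed.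

End GRepIso.

Section GRepExists.
Variables (K : fieldType) (n : nat) (M : gmod K n).
Local Notation E := (extalg K n).

Definition homog_span N := exists (h : 'I_N -> M) (d : 'I_N -> int),
  (forall k, gr (d k) (h k)) /\ forall m, exists c : 'I_N -> K, m = \sum_k ((c k)%:A : E) *: h k.

Lemma homog_span_finite (T : finType) (h : T -> M) (d : T -> int) :
  (forall t, gr (d t) (h t)) -> (forall m, exists c : T -> K, m = \sum_t ((c t)%:A : E) *: h t) ->
  homog_span #|T|.
Proof.
move=> hd hs; exists (h \o enum_val), (d \o enum_val); split=> [k|m]; first exact: hd.
have [c ->] := hs m; exists (c \o enum_val).
rewrite (reindex (enum_val : 'I_#|T| -> T)) //=; exists enum_rank => ? _; [exact: enum_valK|exact: enum_rankK].
Qed.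

Lemma homog_span_exists : exists N, homog_span N.
Proof.
have [r [g gen]] := gm_fg M; have [s us sP] := gr_bounded M.
pose T : finType := ('I_r * ({set 'I_n} * 'I_(size s)))%type.
exists #|T|; apply: (@homog_span_finite T
   (fun t => ext_basis K t.2.1 *: gr_comp (nth 0 s t.2.2) (g t.1))
   (fun t => #|t.2.1|%:Z + nth 0 s t.2.2)).
  move=> t; apply: gr_scale; last exact: gr_comp_gr.
  by move=> A; rewrite ffunE; have [-> //|_] := eqVneq A; rewrite eqxx.
move=> m; have [a ->] := gen m; exists (fun t => a t.1 t.2.1).
rewrite -(pair_bigA _ (fun k (p : {set 'I_n} * 'I_(size s)) =>
  ((a k p.1 : K)%:A : E) *: (ext_basis K p.1 *: gr_comp (nth 0 s p.2) (g k)))).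
apply: eq_bigr => k _ /=.
rewrite -(pair_bigA _ (fun (A : {set 'I_n}) (j : 'I_(size s)) =>
  ((a k A : K)%:A : E) *: (ext_basis K A *: gr_comp (nth 0 s j) (g k)))) /=.
rewrite {1}(ext_sum_basis (a k)) scaler_suml; apply: eq_bigr => A _.
rewrite [in LHS](proj1 (sP (g k))) (big_nth 0) big_mkord scaler_sumr; apply: eq_bigr => j _.
by rewrite scalerA mulr_algl.
Qed.

Lemma homog_basis_exists : exists (N : nat) (h : 'I_N -> M) (d : 'I_N -> int),
  [/\ forall k, gr (d k) (h k),
      forall m, exists c : 'I_N -> K, m = \sum_k ((c k)%:A : E) *: h k
    & forall c : 'I_N -> K, \sum_k ((c k)%:A : E) *: h k = 0 -> forall k, c k = 0].
Proof.
have exQ : exists N, `[< homog_span N >].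
  by have [N hN] := homog_span_exists; exists N; apply/asboolP.
case: (ex_minnP exQ) => N /asboolP[h [d [hd hs]]] minN.
exists N, h, d; split=> // c c0 l; apply/eqP; apply: contraT => cl.
case: N h d hd hs minN c c0 l cl => [|N] h d hd hs minN c c0 l cl; first by case: l {cl}.
have: (N.+1 <= N)%N; last by rewrite ltnn.
apply: minN; apply/asboolP; exists (h \o lift l), (d \o lift l); split=> [k|m]; first exact: hd.
have hl : h l = \sum_(k < N) ((- (c l)^-1 * c (lift l k))%:A : E) *: h (lift l k).
  move/eqP: c0; rewrite (bigD1_ord l) //= addr_eq0 => /eqP/(congr1 (fun x => ((c l)^-1%:A : E) *: x)).
  rewrite scalerA mulr_algl scalerA mulVf // scale1r scale1r => ->.
  rewrite scalerN -scaleNr scaler_sumr; apply: eq_bigr => k _.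
  by rewrite scalerA -scaleNr mulr_algl scalerA.
have [b ->] := hs m.
exists (fun k => b (lift l k) - b l * (c l)^-1 * c (lift l k)).
rewrite (bigD1_ord l) //= hl scaler_sumr -big_split /=; apply: eq_bigr => k _.
rewrite scalerA mulr_algl scalerA -scalerDl -scalerDl addrC mulNr mulrN mulrA //.
Qed.

Lemma gmod_grep : exists (g : grep K n) (phi : grep_iso M g),
  forall k, gr (grep_deg k) (phi (delta_mx 0 k)).
Proof.
have [N [h [d [hd hs hi]]]] := homog_basis_exists.
pose phi (u : 'rV[K]_N) := \sum_k ((u 0 k)%:A : E) *: h k.
have phiL c u v : phi (c *: u + v) = (c%:A : E) *: phi u + phi v.
  rewrite /phi scaler_sumr -big_split; apply: eq_bigr => k _ /=.
  by rewrite !mxE scalerA mulr_algl scalerA -scalerDl -scalerDl.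
have phi0 u : phi u = 0 -> u = 0.
  by move=> u0; apply/rowP => k; rewrite mxE; apply: hi u0 k.
have phi_inj : injective phi.
  move=> u v uv; apply/eqP; rewrite -subr_eq0; apply/eqP/phi0.
  by rewrite addrC -scaleN1r phiL uv scaleN1r scaleN1r addNr.
have phi_surj m : exists u, m = phi u.
  have [c ->] := hs m; exists (\row_k c k).
  by apply: eq_bigr => k _; rewrite mxE.
have phid k : phi (delta_mx 0 k) = h k.
  rewrite /phi (bigD1 k) //= big1 ?addr0 => [|l nl].
    by rewrite mxE !eqxx scale1r scale1r.
  by rewrite mxE (negPf nl) andbF scale0r scale0r.
have /choice [psi psiP] := phi_surj.
pose A i : 'M[K]_N := \matrix_(k, l) psi (ext_gen K i *: h k) 0 l.
have phiA i u : phi (u *m A i) = ext_gen K i *: phi u.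
  rewrite /phi; under eq_bigr => l _.
    rewrite mxE scaler_suml scaler_suml; over.
  rewrite exchange_big scaler_sumr; apply: eq_bigr => k _ /=.
  have -> : ext_gen K i *: ((u 0 k)%:A *: h k) = ((u 0 k)%:A : E) *: (ext_gen K i *: h k).
    by rewrite !scalerA mulr_algl mulr_algr.
  rewrite [_ *: h k]psiP scaler_sumr; apply: eq_bigr => l _.
  by rewrite !mxE [RHS]scalerA mulr_algl scalerA.
have phi00 : phi 0 = 0 by rewrite /phi big1 // => k _; rewrite mxE scale0r scale0r.
have phiN u : phi (- u) = - phi u.
  by have := phiL (-1) u 0; rewrite phi00 !addr0 !scaleN1r.
have A2 i : A i *m A i = 0.
  apply/row_matrixP => k; rewrite !rowE mulmxA; apply: phi_inj.
  by rewrite !phiA scalerA ext_gen_sqr scale0r mulmx0 phi00.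
have AC i j : A i *m A j = - (A j *m A i).
  apply/row_matrixP => k; rewrite !rowE mulmxN !mulmxA; apply: phi_inj.
  by rewrite phiN !phiA !scalerA ext_genC scaleNr.
have Ad i k l : A i k l != 0 -> d l = d k + 1.
  move=> nz; apply/eqP; apply: contraT => nd; move: nz.
  have hk : gr (1 + d k) (ext_gen K i *: h k) by apply: gr_scale => //; apply: ext_gen_homog.
  have nd' : d l != 1 + d k by rewrite addrC.
  have := gr_comp_neq nd' hk; rewrite [_ *: h k]psiP.
  rewrite /phi (big_morph (gr_comp (d l)) (gr_compD (d l)) (gr_comp0 _ _)) => e.
  rewrite mxE; suff -> : psi (ext_gen K i *: h k) 0 l = 0 by rewrite eqxx.
  have := hi (fun l' => if d l' == d l then psi (ext_gen K i *: h k) 0 l' else 0).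
  move=> /(_ _ l); rewrite eqxx; apply; rewrite -[RHS]e; apply: eq_bigr => l' _.
  have hg : gr (d l') (((psi (ext_gen K i *: h k) 0 l')%:A : E) *: h l') by apply: gr_algl.
  have [el|ne] := eqVneq; first by rewrite gr_comp_id // -el.
  by rewrite (gr_comp_neq _ hg) ?scale0r ?scale0r // eq_sym.
pose g := GRep Ad A2 AC.
have phiAg i u : phi (u *m grep_op g i) = ext_gen K i *: phi u := phiA i u.
exists g, (@GRepIso K n M g phi phiL phi_inj phi_surj phiAg) => k /=.
by rewrite phid.
Qed.

End GRepExists.

Section DualIso.
Variables (K : fieldType) (n : nat) (M : gmod K n) (g : grep K n) (phi : grep_iso M g).
Hypothesis phi_gr : forall k, gr (grep_deg k) (phi (delta_mx 0 k)).
Local Notation E := (extalg K n).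

Lemma ract_grep_fun i u :
  ract (phi u) (ext_gen K i) = phi (u *m grep_par g *m grep_op g i).
Proof.
rewrite grep_fun_op (grep_fun_delta phi u) ract_suml (grep_fun_delta phi (u *m _)) scaler_sumr.
apply: eq_bigr => k _; rewrite ract_scalel (gr_signr (@ext_gen_homog K n i) (phi_gr k)).
rewrite mul1r /grep_par mul_mx_diag mxE [X in _ * X]mxE -scalerA.
rewrite ![(-1) ^+ _ *: (_ *: phi _)]scalerA.
have -> : (-1 : E) ^+ absz (grep_deg k) = ((-1) ^+ absz (grep_deg k) : K)%:A.
  by rewrite -in_algE rmorphXn rmorphN1.
by rewrite !scalerA !mulr_algl mulr_algr scalerA.
Qed.

Lemma dual_top_inj (f f' : dual M) :
  (forall u, ext_top (dual_fun f (phi u)) = ext_top (dual_fun f' (phi u))) -> f = f'.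
Proof.
move=> ff; apply: dual_ext => m; apply: ext_topP => a; rewrite -!dual_funZ.
by have [u ->] := grep_fun_surj phi (a *: m).
Qed.

Lemma dual_top_exists (psi : 'rV[K]_(grep_dim g)) :
  exists f : dual M, forall u, ext_top (dual_fun f (phi u)) = (u *m psi^T) 0 0.
Proof.
have /choice [co coP] := grep_fun_surj phi.
have coK u : co (phi u) = u by apply: (@grep_fun_inj _ _ _ _ phi).
pose l m := (co m *m psi^T) 0 0.
have lL c m m' : l ((c%:A : E) *: m + m') = c * l m + l m'.
  rewrite /l; have -> : co ((c%:A : E) *: m + m') = c *: co m + co m'.
    by apply: (@grep_fun_inj _ _ _ _ phi); rewrite -coP grep_fun_linear -!coP.
  by rewrite mulmxDl -scalemxAl !mxE.
have /choice [F FP] : forall m, exists b : E, forall a, ext_top (a * b) = l (a *: m).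
  move=> m; apply: ext_top_repr => c a b.
  by rewrite scalerDl -lL scalerA mulr_algl.
have FL a m m' : F (a *: m + m') = a * F m + F m'.
  apply: ext_topP => b; rewrite FP mulrDr ext_topD mulrA !FP scalerDr scalerA.
  by have := lL 1 ((b * a) *: m) (b *: m'); rewrite scale1r scale1r mul1r.
exists (dual_mk FL) => u.
by have := FP (phi u) 1; rewrite mul1r scale1r /l coK.
Qed.

Lemma dual_grep_iso : inhabited (grep_iso (dual M) (grep_dual g)).
Proof.
have /choice [phi' phi'P] := dual_top_exists.
apply/inhabits/(@GRepIso _ _ (dual M) (grep_dual g) phi') => [c u v|u v uv|f|i psi].
- apply: dual_top_inj => w; rewrite phi'P linearP mulmxDr -scalemxAr mxE [X in X + _]mxE.
  rewrite -!phi'P -ext_topZ -ext_topD; congr (ext_top (_ + _)).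
  by rewrite {2}/dual_fun /= ract_alg -/(dual_fun _) dual_funZ mulr_algl.
- apply/rowP => k; have := phi'P u (delta_mx 0 k); rewrite uv phi'P.
  by rewrite -!rowE !mxE => ->.
- exists (\row_k ext_top (dual_fun f (phi (delta_mx 0 k)))).
  apply: dual_top_inj => u; rewrite phi'P {1}(grep_fun_delta phi u) mxE.
  rewrite (big_morph (dual_fun f) (dual_funD f) (dual_fun0 f)).
  rewrite (big_morph (@ext_top K n) (@ext_topD K n) (_ : ext_top 0 = 0)); last by rewrite /ext_top ffunE.
  by apply: eq_bigr => k _; rewrite dual_funZ mulr_algl ext_topZ !mxE.
- apply: dual_top_inj => u; rewrite phi'P.
  rewrite [in RHS]/dual_fun /= -/(dual_fun _) ract_grep_fun phi'P.
  by rewrite /dual_op !trmx_mul trmxK tr_grep_par !mulmxA.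
Qed.

End DualIso.

(** * Regular sequences and ranks *)

Section AnticommutingMatrices.
Variables (K : fieldType) (m : nat) (X : nat -> 'M[K]_m).
Hypothesis X_sqr : forall k, X k *m X k = 0.
Hypothesis XC : forall k l, X k *m X l = - (X l *m X k).

Definition xsum k : 'M[K]_m := (\sum_(i < k) X i)%MS.

Fixpoint xprod k : 'M[K]_m := if k is k'.+1 then xprod k' *m X k' else 1%:M.

Lemma xsumS k : (xsum k.+1 :=: xsum k + X k)%MS.
Proof. by rewrite /xsum big_ord_recr. Qed.

Lemma xprodC k l : exists e : nat, X l *m xprod k = (-1) ^+ e *: (xprod k *m X l).
Proof.
elim: k => [|k [e IH]] /=; first by exists 0%N; rewrite mulmx1 mul1mx scale1r.
by exists e.+1; rewrite mulmxA IH -scalemxAl -!mulmxA XC mulmxN exprS mulN1r scalerN scaleNr.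
Qed.

Lemma xprodS_eqmx k : (xprod k.+1 :=: X k *m xprod k)%MS.
Proof.
have [e ->] := xprodC k k; apply/eqmx_sym/eqmx_scale.
by rewrite signr_eq0.
Qed.

Lemma xprodS_eq0 k (u : 'rV_m) : (u *m xprod k.+1 == 0) = (u *m X k *m xprod k == 0).
Proof.
have [e] := xprodC k k; rewrite -[u *m X k *m _]mulmxA => ->.
by rewrite -scalemxAr scaler_eq0 signr_eq0.
Qed.

Lemma xprod_eq0 k i : (i < k)%N -> X i *m xprod k = 0.
Proof.
elim: k => // k IH; rewrite ltnS leq_eqVlt => /predU1P[->|/IH e] /=; last first.
  by rewrite mulmxA e mul0mx.
have [e E] := xprodC k k; rewrite mulmxA E -scalemxAl -mulmxA X_sqr mulmx0 scaler0 //.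
Qed.

Lemma xsum_xprod k (u : 'rV_m) : (u <= xsum k)%MS -> u *m xprod k = 0.
Proof.
move=> /sub_sumsmxP[a ->]; rewrite mulmx_suml big1 // => i _.
by rewrite -mulmxA xprod_eq0 // mulmx0.
Qed.

Lemma xsum_mul k l (u : 'rV_m) : (u <= xsum k)%MS -> (u *m X l <= xsum k)%MS.
Proof.
move=> /sub_sumsmxP[a ->]; rewrite mulmx_suml summx_sub // => i _.
by rewrite -mulmxA XC mulmxN -mulNmx mulmxA (sumsmx_sup i) // submxMl.
Qed.

Let exactK s := forall k, (k <= s)%N -> forall u : 'rV_m, u *m xprod k = 0 -> (u <= xsum k)%MS.

Let exact0 (u : 'rV_m) : u *m xprod 0 = 0 -> (u <= xsum 0)%MS.
Proof. by rewrite mulmx1 => ->; apply: sub0mx. Qed.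

Let regular_exactK s : (forall k, (k < s)%N -> forall u : 'rV_m,
    (u *m X k <= xsum k)%MS -> (u <= xsum k + X k)%MS) <-> exactK s.
Proof.
split=> [reg k|ex k ks u uX].
  elim: k => [_|k IH ks u]; first exact: exact0.
  move=> /eqP; rewrite xprodS_eq0 => /eqP/(IH (ltnW ks))/(reg k ks).
  by rewrite xsumS.
by rewrite -xsumS; apply: ex => //; apply/eqP; rewrite xprodS_eq0; apply/eqP/xsum_xprod.
Qed.

Let rank_cap k : (2 * \rank (xprod k.+1) == \rank (xprod k))%N =
  (xprod k :&: kermx (X k) <= xprod k.+1)%MS.
Proof.
have sub : (xprod k.+1 <= xprod k :&: kermx (X k))%MS.
  rewrite sub_capmx xprodS_eqmx submxMl /=; apply/sub_kermxP.
  by rewrite /= -mulmxA X_sqr mulmx0.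
rewrite -(geq_leqif (mxrank_leqif_sup sub)) -(mxrank_mul_ker (xprod k) (X k)).
rewrite mul2n -addnn eqn_add2l eqn_leq -/(xprod k.+1).
by rewrite mxrankS.
Qed.

(* Both sides say that ker (X_0 ... X_(k-1)) is the span of the images of
   X_0, ..., X_(k-1), for every k <= s. *)
Lemma regular_rank s : (forall k, (k < s)%N -> forall u : 'rV_m,
    (u *m X k <= xsum k)%MS -> (u <= xsum k + X k)%MS) <->
  (forall k, (k < s)%N -> (2 * \rank (xprod k.+1) = \rank (xprod k))%N).
Proof.
apply: (iff_trans (regular_exactK s)); split=> [ex k ks|rk].
  apply/eqP; rewrite rank_cap; apply/rV_subP => y; rewrite sub_capmx => /andP[/submxP[u ->]].
  move=> /sub_kermxP; rewrite -mulmxA -/(xprod k.+1) => /(ex _ ks).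
  rewrite xsumS => /sub_addsmxP[[a b] /= ->].
  by rewrite mulmxDl xsum_xprod ?submxMl // add0r xprodS_eqmx -mulmxA submxMl.
elim=> [_|k IH ks u u0]; first exact: exact0.
have : (u *m xprod k <= xprod k :&: kermx (X k))%MS.
  by rewrite sub_capmx submxMl /=; apply/sub_kermxP; rewrite -mulmxA.
move/eqP: (rk k ks); rewrite rank_cap => sub /submx_trans/(_ sub).
rewrite xprodS_eqmx => /submxP[a ea].
have : ((u - a *m X k) <= xsum k)%MS.
  by apply: IH (ltnW ks) _ _; rewrite mulmxBl ea mulmxA subrr.
move=> h; rewrite xsumS -[u](subrK (a *m X k)).
by rewrite addmx_sub_adds // submxMl.
Qed.

End AnticommutingMatrices.

Section RegularRank.
Variables (K : fieldType) (n : nat).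
Local Notation E := (extalg K n).
Implicit Types (g : grep K n) (v w : E).

Definition lin_op g v : 'M[K]_(grep_dim g) := \sum_i v [set i]%SET *: grep_op g i.

Lemma lin_opC g v w : lin_op g v *m lin_op g w = - (lin_op g w *m lin_op g v).
Proof.
rewrite /lin_op mulmx_suml mulmx_sumr -sumrN; apply: eq_bigr => i _.
rewrite mulmx_sumr mulmx_suml -sumrN; apply: eq_bigr => j _.
by rewrite -!scalemxAl -!scalemxAr grep_opC !scalerN !scalerA mulrC.
Qed.

Lemma lin_op_sqr g v : lin_op g v *m lin_op g v = 0.
Proof.
rewrite /lin_op; elim: (index_enum _) => [|i r IH]; first by rewrite big_nil mul0mx.
rewrite big_cons mulmxDl !mulmxDr IH addr0 -scalemxAl -scalemxAr grep_op_sqr !scaler0 add0r.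
rewrite mulmx_sumr mulmx_suml -big_split big1 // => j _ /=.
by rewrite -!scalemxAl -!scalemxAr grep_opC !scalerN !scalerA mulrC addNr.
Qed.

Lemma lin_op_dual g v : lin_op (grep_dual g) v = (lin_op g v)^T *m grep_par g.
Proof.
rewrite /lin_op linear_sum mulmx_suml; apply: eq_bigr => i _.
by rewrite linearZ /= -scalemxAl.
Qed.

Lemma lin_op_par g v : lin_op g v *m grep_par g = - (grep_par g *m lin_op g v).
Proof.
rewrite /lin_op mulmx_suml mulmx_sumr -sumrN; apply: eq_bigr => i _.
by rewrite -scalemxAl -scalemxAr grep_op_par scalerN.
Qed.

Definition seq_op g (vs : seq E) k := lin_op g (nth 0 vs k).

Lemma xprod_dual_rank g vs k :
  \rank (xprod (seq_op (grep_dual g) vs) k) = \rank (xprod (seq_op g vs) k).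
Proof.
pose P (b : bool) := if b then grep_par g else 1%:M.
have PP b : P b *m P b = 1%:M by case: b; rewrite ?mul1mx // grep_parK.
have PS b : P b *m grep_par g = P (~~ b) by case: b; rewrite /= ?mul1mx // grep_parK.
have PX b l : exists e : nat,
    P b *m (seq_op g vs l)^T = (-1) ^+ e *: ((seq_op g vs l)^T *m P b).
  case: b => /=; last by exists 0%N; rewrite mul1mx mulmx1 scale1r.
  exists 1%N; rewrite -tr_grep_par -!trmx_mul lin_op_par linearN /=.
  by rewrite expr1 scaleN1r.
have [e ->] : exists e : nat, xprod (seq_op (grep_dual g) vs) k =
    (-1) ^+ e *: ((xprod (seq_op g vs) k)^T *m P (odd k)).
  elim: k => [|k [e IH]] /=; first by exists 0%N; rewrite trmx1 mul1mx scale1r.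
  rewrite IH [seq_op (grep_dual g) vs k]lin_op_dual -/(seq_op g vs k) -scalemxAl -mulmxA.
  rewrite (mulmxA (P _)); have [e1 ->] := PX (odd k) k.
  have [e2 E2] := xprodC (fun k l => lin_opC g (nth 0 vs k) (nth 0 vs l)) k k.
  rewrite -[X in _ *: (_ *m X)]scalemxAl -scalemxAr -(mulmxA (_ k)^T) PS mulmxA -trmx_mul E2.
  by rewrite [(_ *: _)^T]linearZ /= -scalemxAl !scalerA -!exprD; eexists.
rewrite -[RHS]mxrank_tr.
have rP b : row_free (P b) by rewrite row_free_unit; have [] := mulmx1_unit (PP b).
by rewrite mxrank_scale_nz ?signr_eq0 // mxrankMfree.
Qed.

Variables (M : gmod K n) (g : grep K n) (phi : grep_iso M g).

Lemma grep_fun_lin_op v u : ext_homog 1 v -> phi (u *m lin_op g v) = v *: phi u.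
Proof.
move=> hv; rewrite [in RHS](ext_homog1_gen hv) /lin_op mulmx_sumr grep_fun_sum scaler_suml.
apply: eq_bigr => i _; rewrite -scalemxAr grep_funZ grep_fun_op.
by rewrite scalerA mulr_algl.
Qed.

Lemma seq_mul_xsum vs u : (forall k, (k < size vs)%N -> ext_homog 1 (nth 0 vs k)) ->
  seq_mul (M := M) vs (phi u) <-> (u <= xsum (seq_op g vs) (size vs))%MS.
Proof.
move=> hv; split=> [[x ex]|/sub_sumsmxP[a ->]].
  have /choice [y yP] := grep_fun_surj phi.
  apply/sub_sumsmxP; exists (fun k : 'I_(size vs) => y (x k)); apply: (@grep_fun_inj _ _ _ _ phi).
  rewrite ex grep_fun_sum; apply: eq_bigr => k _.
  by rewrite (grep_fun_lin_op _ (hv k _)) // -yP.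
exists (fun k => if insub k is Some k' then phi (a k') else 0).
rewrite grep_fun_sum; apply: eq_bigr => k _; rewrite valK.
by rewrite (grep_fun_lin_op _ (hv k _)).
Qed.

Lemma xsum_proper (X : nat -> E) k : (0 < grep_dim g)%N ->
  exists u : 'rV_(grep_dim g), ~~ (u <= xsum (fun i => lin_op g (X i)) k)%MS.
Proof.
move=> m_gt0; pose l0 := [arg min_(l < Ordinal m_gt0) @grep_deg _ _ g l]%O.
have l0P (l : 'I_(grep_dim g)) : grep_deg l0 <= grep_deg l.
  by rewrite /l0; case: arg_minP => // l1 _ /(_ l isT).
have X0 v l : lin_op g v l l0 = 0.
  rewrite /lin_op summxE big1 // => i _; rewrite mxE.
  have [->|/grep_op_deg e] := eqVneq (grep_op g i l l0) 0; first by rewrite mulr0.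
  by have := l0P l; rewrite e gerDl.
exists (delta_mx 0 l0); apply/negP => /sub_sumsmxP[a /matrixP/(_ 0 l0)].
rewrite mxE !eqxx summxE big1 => [|i _]; first by move/eqP; rewrite oner_eq0.
by rewrite mxE big1 // => l _; rewrite X0 mulr0.
Qed.

Lemma regular_seq_rank vs : (0 < grep_dim g)%N ->
  regular_seq M vs <->
  (forall k, (k < size vs)%N -> ext_homog 1 (nth 0 vs k)) /\
  (forall k, (k < size vs)%N ->
    (2 * \rank (xprod (seq_op g vs) k.+1) = \rank (xprod (seq_op g vs) k))%N).
Proof.
move=> m_gt0.
have X2 k : seq_op g vs k *m seq_op g vs k = 0 by apply: lin_op_sqr.
have XC k l : seq_op g vs k *m seq_op g vs l = - (seq_op g vs l *m seq_op g vs k).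
  exact: lin_opC.
have takeP (hv : forall k, (k < size vs)%N -> ext_homog 1 (nth 0 vs k)) k u :
    (k < size vs)%N -> seq_mul (M := M) (take k vs) (phi u) <-> (u <= xsum (seq_op g vs) k)%MS.
  move=> ks; rewrite seq_mul_xsum; last first.
    by move=> i; rewrite size_take ks => ik; rewrite nth_take //; apply/hv/(ltn_trans ik).
  rewrite size_take ks; have -> : xsum (seq_op g (take k vs)) k = xsum (seq_op g vs) k.
    by apply: eq_bigr => i _; rewrite /seq_op nth_take.
  by [].
have regP (hv : forall k, (k < size vs)%N -> ext_homog 1 (nth 0 vs k)) k : (k < size vs)%N ->
    @regular_elt_mod K n M (take k vs) (nth 0 vs k) <->
    (forall u : 'rV_(grep_dim g), (u *m seq_op g vs k <= xsum (seq_op g vs) k)%MS ->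
      (u <= xsum (seq_op g vs) k + seq_op g vs k)%MS).
  move=> ks; have exP u : (exists m', seq_mul (take k vs) (phi u - nth 0 vs k *: m')) <->
      (u <= xsum (seq_op g vs) k + seq_op g vs k)%MS.
    have subE u' : phi u - nth 0 vs k *: phi u' = phi (u - u' *m seq_op g vs k).
      by rewrite -(grep_fun_lin_op _ (hv k ks)) grep_funB.
    split=> [[m']|/sub_addsmxP[[a b] /= ->]].
      have [u' ->] := grep_fun_surj phi m'; rewrite subE takeP // => h.
      by rewrite -[u](subrK (u' *m seq_op g vs k)) addmx_sub_adds // submxMl.
    exists (phi b); rewrite -(grep_fun_lin_op _ (hv k ks)) // -/(seq_op g vs k) grep_funD addrK takeP //.
    exact: submxMl.
  split=> [reg u|reg m].
    rewrite -takeP // (grep_fun_lin_op _ (hv k ks)) //.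
    by move=> /(reg (phi u)); rewrite exP.
  have [u ->] := grep_fun_surj phi m; rewrite exP -(grep_fun_lin_op _ (hv k ks)) // takeP //.
  split; first exact: reg.
  move=> /sub_addsmxP[[a b] /= ->]; rewrite mulmxDl -[b *m _ *m _]mulmxA X2 mulmx0 addr0.
  by apply: xsum_mul XC _ _ _ _; rewrite submxMl.
have rr := regular_rank X2 XC (size vs).
split=> [[hv reg _]|[hv rk]].
  by split=> //; apply/rr => k ks; apply: (regP hv k ks).1; apply: reg.
split=> // [k ks|]; first by apply: (regP hv k ks).2; apply: (rr.2 rk).
have [u /negP nu] := xsum_proper (fun k => nth 0 vs k) (size vs) m_gt0.
by exists (phi u) => /seq_mul_xsum h; apply: nu; apply: h.
Qed.

End RegularRank.

Lemma regular_seq_dual (K : fieldType) (n : nat) (M : gmod K n) (vs : seq (extalg K n)) :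
  (exists m : M, m != 0) -> regular_seq M vs <-> regular_seq (dual M) vs.
Proof.
move=> [m m_neq0]; have [g [phi phi_gr]] := gmod_grep M.
have [phi'] := dual_grep_iso phi_gr.
have g_gt0 : (0 < grep_dim g)%N.
  rewrite lt0n; apply: contra_neqN m_neq0 => /eqP g0.
  have [u ->] := grep_fun_surj phi m; rewrite (_ : u = 0) ?grep_fun0 //.
  by apply/rowP => k; have := ltn_ord k; rewrite [X in (_ < X)%N]g0.
rewrite (regular_seq_rank phi) // (regular_seq_rank phi') //.
split=> -[hv rk]; split=> // k ks; first by rewrite !xprod_dual_rank rk.
by have := rk k ks; rewrite !xprod_dual_rank.
Qed.

Lemma depth_regular_seq (K : fieldType) (n : nat) (M N : gmod K n) :
  (forall vs, regular_seq M vs <-> regular_seq N vs) -> depth M = depth N.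
Proof.
move=> MN; rewrite /depth; congr (xget _ _); apply/seteqP; split=> d dP vs [r mx];
  by apply: dP; split; [apply/MN|move=> v /MN; apply: mx].
Qed.

(** * Resolutions *)

(* Free right modules of column vectors; y in E^(rr_dim 0) is sent to
   sum_k rr_aug k * (constant coefficient of y_k) in K. *)
Record right_resolution (K : fieldType) (n : nat) := RightResolution {
  rr_dim : nat -> nat;
  rr_diff : forall a, 'M[extalg K n]_(rr_dim a, rr_dim a.+1);
  rr_aug : 'I_(rr_dim 0) -> K;
  rr_aug_neq0 : exists k, rr_aug k != 0;
  rr_exact0 : forall y : 'cV[extalg K n]_(rr_dim 0),
    \sum_k rr_aug k * y k 0 finset.set0 = 0 <-> exists z : 'cV_ _, y = rr_diff 0 *m z;
  rr_exact : forall a (y : 'cV_(rr_dim a.+1)),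
    rr_diff a *m y = 0 <-> exists z : 'cV_ _, y = rr_diff a.+1 *m z
}.

Section RightResolution.
Variables (K : fieldType) (n : nat).
Local Notation E := (extalg K n).

Lemma ext_coef0M (x y : E) : (x * y) finset.set0 = x finset.set0 * y finset.set0.
Proof.
rewrite ffunE (bigD1 finset.set0) //= [X in _ + X]big1 ?addr0.
  rewrite (bigD1 finset.set0) //= big1 ?addr0.
    rewrite /ext_coef finset.setU0 eqxx -finset.setI_eq0 finset.setI0 eqxx /=.
    by rewrite /inversions finset.big_set0 mul1r.
  by move=> B nB; rewrite /ext_coef finset.setU_eq0 (negPf nB) !andbF mul0r.
by move=> A nA; rewrite big1 // => B _; rewrite /ext_coef finset.setU_eq0 (negPf nA) andbF mul0r.
Qed.

Lemma ext_gen_coef0 (i : 'I_n) : ext_gen K i finset.set0 = 0 :> K.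
Proof.
rewrite ffunE; case: eqP => // /finset.setP/(_ i).
by rewrite finset.in_set0 finset.set11.
Qed.

Lemma ext_augmentation_ideal (x : E) : x finset.set0 = 0 ->
  exists z : 'I_n -> E, x = \sum_i ext_gen K i * z i.
Proof.
move=> x0; suff: exists c, exists z : 'I_n -> E, x = c%:A + \sum_i ext_gen K i * z i.
  move=> [c [z ez]]; exists z; suff c0 : c = 0 by rewrite {1}ez c0 scale0r add0r.
  have := congr1 (fun y : E => y finset.set0) ez; rewrite /= x0 !ffunE sum_ffunE.
  rewrite big1 => [|i _]; last by rewrite ext_coef0M ext_gen_coef0 mul0r.
  by rewrite eqxx addr0 -[_ *: _]/(c * 1) mulr1.
elim/ext_gen_ind: x {x0} => [||d x y [c [z ->]] [c' [z' ->]]|i x _].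
- by exists 0, (fun=> 0); rewrite scale0r add0r big1 // => i _; rewrite mulr0.
- by exists 1, (fun=> 0); rewrite scale1r big1 ?addr0 // => i _; rewrite mulr0.
- exists (d * c + c'), (fun i => d *: z i + z' i).
  rewrite scalerDr scalerA scalerDl addrACA scaler_sumr -big_split /=; congr (_ + _).
  by apply: eq_bigr => i _; rewrite mulrDr scalerAr.
- exists 0, (fun j => if j == i then x else 0); rewrite scale0r add0r (bigD1 i) //= eqxx.
  by rewrite big1 ?addr0 // => j /negPf->; rewrite mulr0.
Qed.

Lemma col_kernel p q (D : 'M[E]_(p, q)) : exists (r : nat) (D' : 'M[E]_(q, r)),
  forall y : 'cV_q, D *m y = 0 <-> exists z : 'cV_ _, y = D' *m z.
Proof.
pose col (w : {ffun 'I_q -> E}) : 'cV[E]_q := \col_k w k.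
have [||r [h [hP hs]]] := @closed_span K {ffun 'I_q -> E} (fun w => D *m col w = 0).
- rewrite (_ : col 0 = 0) ?mulmx0 //; apply/colP => k; rewrite !mxE ffunE //.
- move=> c x y x0 y0; rewrite (_ : col _ = (\col_k (c *: x k)) + col y); last first.
    by apply/colP => k; rewrite !mxE !ffunE.
  rewrite mulmxDr y0 addr0; apply/colP => k; rewrite mxE.
  have /colP/(_ k) := x0; rewrite !mxE => /(congr1 (fun a : E => c *: a)).
  rewrite scaler0 scaler_sumr => e; rewrite -[RHS]e; apply: eq_bigr => l _.
  by rewrite !mxE -scalerAr.
exists r, (\matrix_(k, l) h l k) => y; split=> [y0|[z ->]].
  have [|c ec] := hs [ffun k => y k 0].
    by rewrite (_ : col _ = y) //; apply/colP => k; rewrite mxE ffunE.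
  exists (\col_l (c l)%:A); apply/colP => k; move/ffunP/(_ k): ec; rewrite ffunE => ->.
  rewrite sum_ffunE mxE; apply: eq_bigr => l _.
  by rewrite !mxE ffunE mulr_algr.
rewrite mulmxA (_ : D *m _ = 0) ?mul0mx //; apply/matrixP => i l; rewrite mxE.
have /colP/(_ i) := hP l; rewrite !mxE => e; rewrite -[RHS]e.
by apply: eq_bigr => k _; rewrite !mxE.
Qed.

Lemma right_resolution_exists : inhabited (right_resolution K n).
Proof.
pose St := {p : nat & {q : nat & 'M[E]_(p, q)}}.
have ker (s : St) : {r : nat & {D' : 'M[E]_(projT1 (projT2 s), r) |
    forall y : 'cV_(projT1 (projT2 s)),
      projT2 (projT2 s) *m y = 0 <-> exists z : 'cV_ _, y = D' *m z}}.
  by have [r /cid D'] := cid (col_kernel (projT2 (projT2 s))); exists r.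
pose s0 : St := existT _ 1%N (existT _ n (\row_i ext_gen K i)).
pose next (s : St) : St := existT _ (projT1 (projT2 s)) (existT _ (projT1 (ker s)) (sval (projT2 (ker s)))).
pose st a := iter a next s0.
constructor; apply: (@RightResolution K n (fun a => projT1 (st a)) (fun a => projT2 (projT2 (st a)))
  (fun=> 1)).
- by exists ord0; apply: oner_neq0.
- move=> y; rewrite /= big_ord1 mul1r; split=> [|[z ->]].
    move=> /ext_augmentation_ideal[z ez]; exists (\col_i z i).
    by apply/colP => k; rewrite ord1 ez mxE; apply: eq_bigr => i _; rewrite !mxE.
  rewrite mxE sum_ffunE big1 // => i _.
  by rewrite ext_coef0M mxE ext_gen_coef0 mul0r.
- by move=> a; apply: (svalP (projT2 (ker (st a)))).
Qed.

End RightResolution.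

Section GradedResolution.
Variables (K : fieldType) (n : nat).
Local Notation E := (extalg K n).

Lemma ext_comp_mulr i j (a b : E) : ext_homog j b -> ext_comp (i + j) (a * b) = ext_comp i a * b.
Proof.
move=> hb; elim/ext_ind: a => [|a a' IH IH'|k a ha].
- by rewrite mul0r !ext_comp0 mul0r.
- by rewrite mulrDl !ext_compD mulrDl IH IH'.
have hab := ext_homogM ha hb.
have [<-|nki] := eqVneq k i; first by rewrite !ext_comp_id.
rewrite (ext_comp_neq _ ha) // mul0r (ext_comp_neq _ hab) //.
by rewrite (inj_eq (addIr j)).
Qed.

Lemma gr_comp_scaler (M : gmod K n) j d (a : E) (m : M) : gr d m ->
  gr_comp j (a *: m) = ext_comp (j - d) a *: m.
Proof.
move=> hm; elim/ext_ind: a => [|a a' IH IH'|k a ha].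
- by rewrite scale0r gr_comp0 ext_comp0 scale0r.
- by rewrite scalerDl gr_compD ext_compD scalerDl IH IH'.
have ham := gr_scale ha hm.
have [ek|nk] := eqVneq k (j - d).
  have ej : j = k + d by rewrite ek subrK.
  by rewrite ej addrK ext_comp_id // gr_comp_id.
rewrite (ext_comp_neq nk ha) scale0r; apply: gr_comp_neq ham.
by apply: contraNneq nk => ->; rewrite addrK.
Qed.

Section Rows.
Variables (q : nat) (d : 'I_q -> int).

Definition row_comp (j : int) (x : 'rV[E]_q) : 'rV[E]_q := \row_l ext_comp (j - d l) (x 0 l).

Lemma row_comp_decomp : exists js : seq int, forall x : 'rV[E]_q,
  x = \sum_(j < size js) row_comp (nth 0 js j) x.
Proof.
pose js := undup [seq (c : int) + d l | c <- [seq Posz k | k <- iota 0 n.+1], l <- enum 'I_q].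
exists js => x; apply/rowP => l; rewrite summxE.
under eq_bigr do rewrite mxE.
rewrite -(big_mkord xpredT (fun j => ext_comp (nth 0 js j - d l) (x 0 l))) -(big_nth 0 xpredT
  (fun j => ext_comp (j - d l) (x 0 l))).
apply/ffunP => A; rewrite sum_ffunE.
have Aj : #|A|%:Z + d l \in js.
  rewrite mem_undup; apply/allpairsP; exists (Posz #|A|, l); split=> //; last by rewrite mem_enum.
  apply/mapP; exists #|A| => //; rewrite mem_iota /= add0n ltnS.
  by rewrite -[X in (_ <= X)%N]card_ord max_card.
rewrite (bigD1_seq _ Aj) ?undup_uniq //= ffunE addrK eqxx big1 ?addr0 // => j nj.
by rewrite ffunE; case: eqP => // eA; rewrite eA subrK eqxx in nj.
Qed.

Lemma graded_rows (N : 'rV[E]_q -> Prop) : N 0 ->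
  (forall a x y, N x -> N y -> N (a *: x + y)) -> (forall j x, N x -> N (row_comp j x)) ->
  exists (s : nat) (ds : 'I_s -> int) (D : 'M[E]_(s, q)),
    (forall k l, ext_homog (ds k - d l) (D k l)) /\
    forall x, N x <-> exists y : 'rV_s, x = y *m D.
Proof.
move=> N0 ND Nj; pose row (w : {ffun 'I_q -> E}) : 'rV[E]_q := \row_k w k.
have rowZD (c : K) w w' : row (c *: w + w') = c%:A *: row w + row w'.
  by apply/rowP => k; rewrite !mxE !ffunE mulr_algl.
have [||r [h [hP hs]]] := @closed_span K {ffun 'I_q -> E} (fun w => N (row w)).
- by rewrite (_ : row 0 = 0) //; apply/rowP => k; rewrite !mxE ffunE.
- by move=> c x y Nx Ny; rewrite rowZD; apply: ND.
have [js jsP] := row_comp_decomp.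
pose T : finType := ('I_r * 'I_(size js))%type.
pose D : 'M[E]_(#|T|, q) := \matrix_(t, l)
  row_comp (nth 0 js (enum_val t : T).2) (row (h (enum_val t : T).1)) 0 l.
exists #|T|, (fun t => nth 0 js (enum_val t : T).2), D; split=> [k l|x].
  by rewrite mxE mxE; apply: ext_comp_homog.
split=> [Nx|[y ->]].
  have [|c ec] := hs [ffun k => x 0 k].
    by rewrite (_ : row _ = x) //; apply/rowP => k; rewrite mxE ffunE.
  exists (\row_t (c (enum_val t : T).1)%:A).
  have -> : x = \sum_k (c k)%:A *: row (h k).
    apply/rowP => k; move/ffunP/(_ k): ec; rewrite ffunE => ->.
    by rewrite sum_ffunE summxE; apply: eq_bigr => l _; rewrite ffunE !mxE mulr_algl.
  apply/rowP => l; rewrite summxE mxE.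
  under [RHS]eq_bigr do rewrite !mxE.
  rewrite -(reindex (enum_val : 'I_#|T| -> T) (P := xpredT) (F := fun t : T =>
    (c t.1)%:A * ext_comp (nth 0 js t.2 - d l) (h t.1 l))) /=; last first.
    by exists enum_rank => ? _; [exact: enum_valK|exact: enum_rankK].
  rewrite -(pair_bigA _ (fun k (j : 'I_(size js)) =>
    (c k)%:A * ext_comp (nth 0 js j - d l) (h k l))) /=.
  apply: eq_bigr => k _; rewrite {1}(jsP (row (h k))) mxE summxE mulr_sumr.
  by apply: eq_bigr => j _; rewrite !mxE.
rewrite mulmx_sum_row; elim/big_rec: _ => // t z _ Nz; apply: ND => //.
rewrite (_ : matrix.row t D = row_comp (nth 0 js (enum_val t : T).2) (row (h (enum_val t : T).1))).
  exact: Nj.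
by apply/rowP => l; rewrite !mxE.
Qed.

Lemma graded_kernel r (dr : 'I_r -> int) (D : 'M[E]_(q, r)) :
  (forall k l, ext_homog (d k - dr l) (D k l)) ->
  exists (s : nat) (ds : 'I_s -> int) (D' : 'M[E]_(s, q)),
    (forall k l, ext_homog (ds k - d l) (D' k l)) /\
    forall x : 'rV_q, x *m D = 0 <-> exists y : 'rV_s, x = y *m D'.
Proof.
move=> hD; apply: graded_rows => [|a x y x0 y0|j x x0]; first exact: mul0mx.
  by rewrite mulmxDl -scalemxAl x0 y0 scaler0 addr0.
apply/rowP => l; rewrite !mxE.
have /rowP/(_ l) := x0; rewrite !mxE => /(congr1 (ext_comp (j - dr l))).
rewrite ext_comp0 ext_comp_sum => e; rewrite -[RHS]e; apply: eq_bigr => k _.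
by rewrite mxE -(ext_comp_mulr _ _ (hD k l)) addrA subrK.
Qed.

End Rows.

Lemma graded_resolution_exists (M : gmod K n) : exists F : graded_free_resolution M, True.
Proof.
have [g [phi phi_gr]] := gmod_grep M.
have [|||s0 [ds0 [D0 [hD0 D0P]]]] := @graded_rows _ (@grep_deg _ _ g)
  (fun x => \sum_k x 0 k *: phi (delta_mx 0 k) = 0).
- by rewrite big1 // => k _; rewrite mxE scale0r.
- move=> a x y x0 y0; transitivity (a *: (\sum_k x 0 k *: phi (delta_mx 0 k)) +
    \sum_k y 0 k *: phi (delta_mx 0 k)); last by rewrite x0 y0 scaler0 addr0.
  rewrite scaler_sumr -big_split; apply: eq_bigr => k _; by rewrite !mxE scalerDl scalerA.
- move=> j x /(congr1 (gr_comp j)).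
  rewrite gr_comp0 (big_morph (gr_comp j) (gr_compD j) (gr_comp0 _ _)) => e.
  by rewrite -[RHS]e; apply: eq_bigr => k _; rewrite mxE (gr_comp_scaler _ _ (phi_gr k)).
pose St := {r : nat & {dr : 'I_r -> int & {q : nat & {dq : 'I_q -> int &
  {D : 'M[E]_(q, r) | forall k l, ext_homog (dq k - dr l) (D k l)}}}}}.
pose tgt (s : St) := projT1 s.
pose tdeg (s : St) : 'I_(tgt s) -> int := projT1 (projT2 s).
pose src (s : St) := projT1 (projT2 (projT2 s)).
pose sdeg (s : St) : 'I_(src s) -> int := projT1 (projT2 (projT2 (projT2 s))).
pose mat (s : St) : 'M[E]_(src s, tgt s) := sval (projT2 (projT2 (projT2 (projT2 s)))).
have matP (s : St) : forall k l, ext_homog (sdeg s k - tdeg s l) (mat s k l).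
  exact: svalP (projT2 (projT2 (projT2 (projT2 s)))).
have ker (s : St) : {r : nat & {dr : 'I_r -> int & {D' : 'M[E]_(r, src s) |
    (forall k l, ext_homog (dr k - sdeg s l) (D' k l)) /\
    forall x : 'rV_(src s), x *m mat s = 0 <-> exists y : 'rV_r, x = y *m D'}}}.
  have [r /cid[dr /cid D']] := cid (graded_kernel (matP s)).
  by exists r, dr.
pose next (s : St) : St := existT _ (src s) (existT _ (sdeg s) (existT _ (projT1 (ker s))
  (existT _ (projT1 (projT2 (ker s)))
    (exist _ (sval (projT2 (projT2 (ker s)))) (proj1 (svalP (projT2 (projT2 (ker s))))))))).
pose st0 : St := existT _ (grep_dim g) (existT _ (@grep_deg _ _ g) (existT _ s0 (existT _ ds0
  (exist _ D0 hD0)))).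
pose st a := iter a next st0.
unshelve eexists; last by [].
apply: (@GradedFreeResolution K n M (fun a => tgt (st a)) (fun a => tdeg (st a))
  (fun k => phi (delta_mx 0 k)) (fun a => mat (st a))).
- exact: phi_gr.
- by move=> i; apply: matP.
- move=> m; have [u ->] := grep_fun_surj phi m; exists (\row_k (u 0 k)%:A).
  by rewrite (grep_fun_delta phi u); apply: eq_bigr => k _; rewrite mxE.
- exact: D0P.
- by move=> i; apply: (proj2 (svalP (projT2 (projT2 (ker (st i)))))).
Qed.

End GradedResolution.

(** * Comparison with Tor *)

(* Both sides are dim ker (f' g) - dim (ker f + ker g). *)
Lemma square_homology (K : fieldType) (X Y Z W : vectType K) (f : 'Hom(X, Y)) (g : 'Hom(X, Z))
    (f' : 'Hom(Z, W)) (g' : 'Hom(Y, W)) : (forall x, f' (g x) = g' (f x)) ->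
  (\dim (lker f' :&: limg g) - \dim (g @: lker f) =
   \dim (lker g' :&: limg f) - \dim (f @: lker g))%N.
Proof.
move=> fg.
have half (Y1 Z1 : vectType K) (f1 : 'Hom(X, Y1)) (g1 : 'Hom(X, Z1)) (h1 : 'Hom(Z1, W)) :
    (\dim (lker g1) + \dim (lker h1 :&: limg g1) = \dim (lker (h1 \o g1)))%N.
  rewrite -(limg_ker_dim g1 (lker (h1 \o g1))).
  congr (_ + _)%N; congr (\dim _); apply/vspaceP => x.
    rewrite memv_cap !memv_ker lfunE /=.
    by case: eqP => [->|]; rewrite ?linear0 ?eqxx // andbF.
  rewrite memv_cap memv_ker; apply/andP/memv_imgP => [[x0 /memv_imgP[y _ ey]]|[y + ->]].
    by exists y => //; rewrite memv_ker lfunE /= -ey.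
  by rewrite memv_ker lfunE /= => -> ; rewrite memv_img ?memvf.
have eU : lker (f' \o g) = lker (g' \o f).
  by apply/vspaceP => x; rewrite !memv_ker !lfunE /= fg.
have h1 := half _ _ f g f'; have h2 := half _ _ g f g'; rewrite -eU in h2.
have k1 := limg_ker_dim g (lker f); have k2 := limg_ker_dim f (lker g).
rewrite capvC in k2.
have arith (U kf kg c a a' b b' : nat) : (kg + a = U -> kf + a' = U -> c + b = kf ->
  c + b' = kg -> a - b = a' - b')%N by lia.
exact: arith h1 h2 k1 k2.
Qed.

Section FreeModule.
Variables (K : fieldType) (n r : nat).
Local Notation E := (extalg K n).

Fact fmod_subproof i : linear (fun x : {ffun 'I_r -> E} =>
  [ffun l => ext_gen K i * x l] : {ffun 'I_r -> E}).
Proof. by move=> c x y; apply/ffunP => l; rewrite !ffunE mulrDr scalerAr. Qed.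

Definition fmod_op i := mklfun (fmod_subproof i).

Fact fmod_sqr i x : fmod_op i (fmod_op i x) = 0.
Proof. by apply/ffunP => l; rewrite !mklfunE !ffunE mulrA ext_gen_sqr mul0r. Qed.

Fact fmodC i j x : fmod_op i (fmod_op j x) = - fmod_op j (fmod_op i x).
Proof. by apply/ffunP => l; rewrite [RHS]ffunE !mklfunE !ffunE !mulrA ext_genC mulNr. Qed.

Definition fmod : emod K n := EMod fmod_sqr fmodC.

Lemma fmod_opE i (x : fmod) l : eop fmod i x l = ext_gen K i * x l.
Proof. by rewrite mklfunE ffunE. Qed.

Lemma fmod_act a (x : fmod) : ext_act a x = [ffun l => a * x l].
Proof.
apply/esym; apply: (ext_act_unique (V := fmod) (f := fun a => [ffun l => a * x l])).
- by apply/ffunP => l; rewrite ffunE mul1r.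
- by move=> c b b'; apply/ffunP => l; rewrite !ffunE mulrDl scalerAl.
- by move=> i b; apply/ffunP => l; rewrite fmod_opE !ffunE mulrA.
Qed.

End FreeModule.
Arguments fmod : clear implicits.

Section TorComparison.
Variables (K : fieldType) (n : nat) (M : gmod K n).
Local Notation E := (extalg K n).
Variables (F : graded_free_resolution M) (P : right_resolution K n).
Variables (g : grep K n) (phi : grep_iso M g).
Local Notation r := (res_rank F).
Local Notation p := (rr_dim P).
Local Notation V := (grep_emod g).

Fact free_diff_subproof b : linear (fun x : fmod K n (r b.+1) =>
  [ffun l => \sum_k x k * res_diff F b k l] : fmod K n (r b)).
Proof.
move=> c x y; apply/ffunP => l; rewrite !ffunE scaler_sumr -big_split.
by apply: eq_bigr => k _; rewrite !ffunE mulrDl -scalerAl.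
Qed.

Definition free_diff b : 'Hom(fmod K n (r b.+1), fmod K n (r b)) :=
  @mklfun K (fmod K n (r b.+1)) (fmod K n (r b)) _ (@free_diff_subproof b).

Lemma free_diffE b x l : free_diff b x l = \sum_k x k * res_diff F b k l.
Proof. by rewrite mklfunE ffunE. Qed.

Lemma free_diff_morph b : emorph (free_diff b).
Proof.
move=> i x; apply/ffunP => l; rewrite fmod_opE !free_diffE mulr_sumr.
by apply: eq_bigr => k _; rewrite fmod_opE mulrA.
Qed.

Lemma free_diff_exact b : lker (free_diff b) = limg (free_diff b.+1).
Proof.
have toE b' (y : fmod K n (r b'.+1)) l : free_diff b' y l = ((\row_k y k) *m res_diff F b') 0 l.
  by rewrite free_diffE mxE; apply: eq_bigr => k _; rewrite mxE.
have ex (x : fmod K n (r b.+1)) := @res_exact _ _ _ F b (\row_k x k).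
apply/vspaceP => x; rewrite memv_ker; apply/eqP/memv_imgP => [x0|[y _ ->]].
  have [|y /rowP ey] := (ex x).1.
    by apply/rowP => l; rewrite -toE x0 mxE ffunE.
  exists [ffun k => y 0 k]; rewrite ?memvf //; apply/ffunP => l; rewrite toE.
  have := ey l; rewrite mxE => ->; congr ((_ *m _) 0 l).
  by apply/rowP => k; rewrite mxE ffunE.
have /rowP e : (\row_k free_diff b.+1 y k) *m res_diff F b = 0.
  by apply/(ex _); exists (\row_k y k); apply/rowP => l; rewrite mxE toE.
by apply/ffunP => l; rewrite toE e mxE ffunE.
Qed.

Lemma aug_key : {h : 'Hom(fmod K n (r 0), V) |
  forall x, phi (h x) = \sum_k x k *: res_aug (g := F) k}.
Proof.
apply: cid; have /choice [co coP] := grep_fun_surj phi.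
have hL : linear (fun x : fmod K n (r 0) => co (\sum_k x k *: res_aug (g := F) k)).
  move=> c x y; apply: (@grep_fun_inj _ _ _ _ phi); rewrite -coP grep_fun_linear -!coP.
  rewrite scaler_sumr -big_split; apply: eq_bigr => k _.
  by rewrite !ffunE scalerDl scalerA mulr_algl.
by exists (mklfun hL) => x; rewrite (mklfunE hL) -coP.
Qed.

Definition free_aug : 'Hom(fmod K n (r 0), V) := sval aug_key.

Lemma free_augE x : phi (free_aug x) = \sum_k x k *: res_aug (g := F) k.
Proof. exact: (svalP aug_key). Qed.

Lemma free_aug_morph : emorph free_aug.
Proof.
move=> i x; apply: (@grep_fun_inj _ _ _ _ phi); rewrite /= grep_emod_opE grep_fun_op !free_augE.
by rewrite scaler_sumr; apply: eq_bigr => k _; rewrite fmod_opE scalerA.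
Qed.

Lemma free_aug_surj : limg free_aug = fullv.
Proof.
apply/vspaceP => v; rewrite memvf; apply/memv_imgP.
have [x ex] := res_aug_surj F (phi v); exists [ffun k => x 0 k]; rewrite ?memvf //.
apply: (@grep_fun_inj _ _ _ _ phi); rewrite free_augE ex.
by apply: eq_bigr => k _; rewrite ffunE.
Qed.

Lemma free_aug_exact : lker free_aug = limg (free_diff 0).
Proof.
apply/vspaceP => x; rewrite memv_ker.
have ex := @res_exact0 _ _ _ F (\row_k x k).
have e1 : (free_aug x == 0) <-> \sum_k (\row_k x k) ord0 k *: res_aug (g := F) k = 0.
  have -> : \sum_k (\row_k x k) ord0 k *: res_aug (g := F) k = phi (free_aug x).
    by rewrite free_augE; apply: eq_bigr => k _; rewrite mxE.
  split=> [/eqP ->|e0]; first exact: grep_fun0.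
  by apply/eqP; apply: (@grep_fun_inj _ _ _ _ phi); rewrite e0 grep_fun0.
apply/idP/memv_imgP => [/e1/ex[y /rowP ey]|[y _ ey]].
  exists [ffun k => y 0 k]; rewrite ?memvf //; apply/ffunP => l; rewrite free_diffE.
  by have := ey l; rewrite !mxE => ->; apply: eq_bigr => k _; rewrite ffunE.
apply/e1/ex; exists (\row_k y k); apply/rowP => l; rewrite ey !mxE free_diffE.
by apply: eq_bigr => k _; rewrite mxE.
Qed.

Lemma ffmap_exact (U1 U2 U3 : vectType K) s (a : 'Hom(U1, U2)) (b : 'Hom(U2, U3)) :
  lker b = limg a -> lker (ffmap s b) = limg (ffmap s a).
Proof.
move=> ab; apply/vspaceP => y; rewrite memv_ker; apply/eqP/memv_imgP => [y0|[x _ ->]].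
  exists (ffmap s a^-1%VF y); rewrite ?memvf //; apply/ffunP => k; rewrite !ffmapE limg_lfunVK //.
  by rewrite -ab memv_ker -ffmapE y0 ffunE.
apply/ffunP => k; rewrite !ffmapE ffunE; apply/eqP; rewrite -memv_ker ab.
by apply: memv_img; apply: memvf.
Qed.

Lemma ffmap_surj (U1 U2 : vectType K) s (a : 'Hom(U1, U2)) :
  limg a = fullv -> limg (ffmap s a) = fullv.
Proof.
move=> aT; apply/vspaceP => y; rewrite memvf; apply/memv_imgP.
exists (ffmap s a^-1%VF y); rewrite ?memvf //; apply/ffunP => k; rewrite !ffmapE limg_lfunVK //.
by rewrite aT memvf.
Qed.

(* The double complex with (a, b) entry E^(rr_dim a) (x) E^(res_rank b). *)
Definition dcol a b := tens (fmod K n (r b)) (rr_diff P a).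
Definition drow a b := ffmap (p a) (free_diff b).

Lemma dcolE a b y k l : dcol a b y k l = (rr_diff P a *m (\col_i y i l)) k 0.
Proof.
rewrite tensE sum_ffunE mxE; apply: eq_bigr => i _.
by rewrite fmod_act ffunE mxE.
Qed.

Lemma dcol_exact a b : lker (dcol a b) = limg (dcol a.+1 b).
Proof.
apply/vspaceP => y; rewrite memv_ker; apply/eqP/memv_imgP => [y0|[x _ ->]].
  have /choice [z zP] : forall l, exists z : 'cV_(p a.+2), \col_i y i l = rr_diff P a.+1 *m z.
    by move=> l; apply/rr_exact/colP => k; rewrite -dcolE y0 mxE !ffunE.
  exists [ffun i => [ffun l => z l i 0]]; rewrite ?memvf //.
  apply/ffunP => k; apply/ffunP => l; rewrite dcolE.
  have /colP/(_ k) := zP l; rewrite mxE => ->; congr ((_ *m _) k 0).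
  by apply/colP => i; rewrite mxE !ffunE.
apply/ffunP => k; apply/ffunP => l; rewrite dcolE !ffunE.
have /colP/(_ k) : rr_diff P a *m (\col_i dcol a.+1 b x i l) = 0.
  apply/rr_exact; exists (\col_i x i l); apply/colP => i; rewrite mxE dcolE //.
by rewrite [RHS]mxE => ->.
Qed.

Lemma dsquare a b x : dcol a b (drow a.+1 b x) = drow a b (dcol a b.+1 x).
Proof. by rewrite (ffmap_tens _ _ (@free_diff_morph b)). Qed.

Lemma drow_exact a b : lker (drow a b) = limg (drow a b.+1).
Proof. exact/ffmap_exact/free_diff_exact. Qed.

(* By square_homology this only depends on a + b. *)
Definition zigzag a b :=
  (\dim (limg (dcol a b) :&: limg (drow a b)) - \dim (limg (dcol a b \o drow a.+1 b)))%N.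

Lemma limg_dsquare a b : limg (dcol a b \o drow a.+1 b) = limg (drow a b \o dcol a b.+1).
Proof. by congr (limg _); apply/lfunP => x; rewrite !lfunE /= dsquare. Qed.

Lemma zigzagS a b : zigzag a.+1 b = zigzag a b.+1.
Proof.
have := square_homology (f := dcol a b.+1) (g := drow a.+1 b) (@dsquare a b).
rewrite !dcol_exact !drow_exact /zigzag => e.
by rewrite limg_dsquare !limg_comp e capvC.
Qed.

Lemma zigzag0 i : zigzag i 0 = zigzag 0 i.
Proof.
suff h a b : zigzag (a + b) 0 = zigzag a b by rewrite -(h 0%N i).
by elim: b a => [|b IH] a; rewrite ?addn0 // -zigzagS -IH addSnnS.
Qed.

Lemma zigzag_rep i :
  zigzag i 0 = tens_homology (rr_diff P i) (rr_diff P i.+1) V.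
Proof.
have sq a x : tens V (rr_diff P a) (ffmap (p a.+1) free_aug x) = ffmap (p a) free_aug (dcol a 0 x).
  by rewrite (ffmap_tens _ _ free_aug_morph).
have := square_homology (f := dcol i 0) (g := ffmap (p i.+1) free_aug) (sq i).
rewrite (ffmap_surj _ free_aug_surj) capvf dcol_exact (ffmap_exact _ free_aug_exact).
rewrite -[limg (ffmap _ (free_diff 0))]/(limg (drow _ 0)) (ffmap_exact _ free_aug_exact).
rewrite -[limg (ffmap _ (free_diff 0))]/(limg (drow _ 0)) /zigzag limg_comp capvC => <-.
congr (_ - \dim _)%N; rewrite -limg_comp.
have -> : (ffmap (p i.+1) free_aug \o dcol i.+1 0 =
  tens V (rr_diff P i.+1) \o ffmap (p i.+2) free_aug)%VF.
  by apply/lfunP => x; rewrite !lfunE /= sq.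
by rewrite limg_comp (ffmap_surj _ free_aug_surj).
Qed.

Fact eps_subproof b : linear (fun y : {ffun 'I_(p 0) -> fmod K n (r b)} =>
  \row_l \sum_k rr_aug (r := P) k * (y k : {ffun 'I_(r b) -> E}) l finset.set0 : 'rV[K]_(r b)).
Proof.
move=> c x y; apply/rowP => l; rewrite !mxE mulr_sumr -big_split.
apply: eq_bigr => k _; rewrite !ffunE mulrDr; congr (_ + _).
by rewrite -[_ *: _]/(_ * _) mulrCA.
Qed.

Definition eps b : 'Hom({ffun 'I_(p 0) -> fmod K n (r b)}, 'rV[K]_(r b)) :=
  mklfun (@eps_subproof b).

Lemma epsE b y l : eps b y 0 l = \sum_k rr_aug (r := P) k * (y k : {ffun 'I_(r b) -> E}) l finset.set0.
Proof. by rewrite mklfunE mxE. Qed.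

Lemma eps_exact b : lker (eps b) = limg (dcol 0 b).
Proof.
have ex (y : {ffun 'I_(p 0) -> fmod K n (r b)}) l := @rr_exact0 _ _ P (\col_k y k l).
have exE (y : {ffun 'I_(p 0) -> fmod K n (r b)}) l :
    \sum_k rr_aug (r := P) k * (\col_k y k l) k 0 finset.set0 = eps b y 0 l.
  by rewrite epsE; apply: eq_bigr => k _; rewrite mxE.
apply/vspaceP => y; rewrite memv_ker; apply/eqP/memv_imgP => [y0|[x _ ->]].
  have /choice [z zP] : forall l, exists z : 'cV_(p 1), \col_i y i l = rr_diff P 0 *m z.
    by move=> l; apply/ex; rewrite exE y0 mxE.
  exists [ffun i => [ffun l => z l i 0]]; rewrite ?memvf //.
  apply/ffunP => k; apply/ffunP => l; rewrite dcolE.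
  have /colP/(_ k) := zP l; rewrite mxE => ->; congr ((_ *m _) k 0).
  by apply/colP => i; rewrite mxE !ffunE.
apply/rowP => l; rewrite mxE -exE; apply/ex.
by exists (\col_i x i l); apply/colP => i; rewrite mxE dcolE.
Qed.

Lemma eps_surj b : limg (eps b) = fullv.
Proof.
apply/vspaceP => u; rewrite memvf; apply/memv_imgP.
have [k0 nk0] := rr_aug_neq0 P.
exists [ffun k => [ffun l => if k == k0 then ((rr_aug (r := P) k0)^-1 * u 0 l)%:A else 0]]; rewrite ?memvf //.
apply/rowP => l; rewrite epsE (bigD1 k0) //= big1 ?addr0.
  by rewrite !ffunE eqxx !ffunE eqxx -[_ *: _]/(_ * _) mulr1 mulrA mulfV // mul1r.
by move=> k /negPf nk; rewrite !ffunE nk !ffunE mulr0.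
Qed.

Definition tor_lfun b : 'Hom('rV[K]_(r b.+1), 'rV[K]_(r b)) := linfun (mulmxr (tor_diff F b)).

Lemma eps_square b x : eps b (drow 0 b x) = tor_lfun b (eps b.+1 x).
Proof.
apply/rowP => l; rewrite epsE lfunE mxE.
under [RHS]eq_bigr => k _ do rewrite epsE mulr_suml.
rewrite exchange_big; apply: eq_bigr => i _ /=.
rewrite /drow ffmapE free_diffE sum_ffunE mulr_sumr; apply: eq_bigr => k _.
by rewrite ext_coef0M mxE mulrA.
Qed.

Lemma dim_limg_mulmxr (s t : nat) (A : 'M[K]_(s, t)) :
  \dim (limg (linfun (mulmxr A) : 'Hom('rV[K]_s, 'rV[K]_t))) = \rank A.
Proof.
set f := linfun _.
have fE u : f u = u *m A by rewrite lfunE.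
pose B : 'M[K]_(\dim (limg f), t) := \matrix_i ((vbasis (limg f))`_i : 'rV[K]_t).
have Bi i : row i B = (vbasis (limg f))`_i by rewrite rowK.
have subBA : (B <= A)%MS.
  apply/row_subP => i; rewrite Bi.
  have /memv_imgP[u _ ->] : (vbasis (limg f))`_i \in limg f.
    by apply: vbasis_mem; rewrite mem_nth ?size_tuple.
  by rewrite fE submxMl.
have subAB : (A <= B)%MS.
  apply/row_subP => i; rewrite rowE -fE.
  have fi : f (delta_mx 0 i) \in limg f by apply: memv_img; apply: memvf.
  by rewrite (coord_vbasis fi); apply: summx_sub => k _; rewrite scalemx_sub // -Bi row_sub.
have freeB : row_free B.
  apply: inj_row_free => v; rewrite mulmx_sum_row => v0.
  apply/rowP => i; rewrite mxE.
  have /freeP fr := basis_free (vbasisP (limg f)); apply: (fr (fun i => v 0 i)).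
  by rewrite -[RHS]v0; apply: eq_bigr => j _; rewrite Bi.
have /eqmxP eBA : (B == A)%MS by rewrite subBA subAB.
by rewrite -eBA; apply/esym/eqP.
Qed.

Lemma zigzag_tor i :
  zigzag 0 i = (\rank (tor_cycles F i.+1) - \rank (tor_diff F i.+1))%N.
Proof.
have := square_homology (f := eps i.+1) (g := drow 0 i) (@eps_square i).
rewrite eps_surj capvf eps_exact drow_exact eps_exact -[X in _ = (_ - \dim X)%N]limg_comp.
have -> : (eps i.+1 \o drow 0 i.+1 = tor_lfun i.+1 \o eps i.+2)%VF.
  by apply/lfunP => x; rewrite !lfunE /= eps_square.
rewrite limg_comp eps_surj dim_limg_mulmxr /zigzag limg_dsquare limg_comp => ->.
congr (_ - _)%N; rewrite /= mxrank_ker -dim_limg_mulmxr.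
have e := limg_ker_dim (tor_lfun i) fullv.
rewrite capfv dimvf in e.
have d : dim 'rV[K]_(r i.+1) = r i.+1 by rewrite /dim /= mul1n.
by rewrite -[LHS](addnK (\dim (limg (tor_lfun i)))) e d.
Qed.

Lemma tor_tens_homology i : (\rank (tor_cycles F i.+1) - \rank (tor_diff F i.+1))%N =
  tens_homology (rr_diff P i) (rr_diff P i.+1) V.
Proof. by rewrite -zigzag_tor -zigzag0 zigzag_rep. Qed.

End TorComparison.

(** * Betti numbers and complexity *)

Section Strands.
Variables (K : fieldType) (r : nat) (d : 'I_r -> int).

Definition strand (j : int) : 'M[K]_r := diag_mx (\row_k (d k == j)%:R).

Lemma strandE j k l : strand j k l = ((k == l) && (d k == j))%:R.
Proof. by rewrite !mxE; case: (k == l); rewrite ?mulr1n ?mulr0n. Qed.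

Lemma strandM i j : strand i *m strand j = if i == j then strand i else 0.
Proof.
apply/matrixP => k l; rewrite {1}/strand mul_diag_mx mxE strandE mxE.
case: (eqVneq i j) => [<-|ij]; first by rewrite strandE andbC; case: eqP; rewrite /= ?mul1r ?mul0r.
rewrite mxE; case: (k == l) => /=; last by rewrite mulr0.
by case: (eqVneq (d k) i) => [->|_]; rewrite ?mul0r // (negPf ij) mulr0.
Qed.

Variables (m : nat) (X : 'M[K]_(m, r)).
Hypothesis stableX : forall j, (X *m strand j <= X)%MS.

Lemma rank_strand_cap j : \rank (strand j :&: X) = \rank (X *m strand j).
Proof.
apply/eqmx_rank/andP; split; last by rewrite sub_capmx submxMl stableX.
apply/rV_subP => u; rewrite sub_capmx => /andP[/submxP[b eb] /submxP[a ea]].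
have -> : u = u *m strand j by rewrite {2}eb -mulmxA strandM eqxx -eb.
by rewrite ea -mulmxA submxMl.
Qed.

Lemma rank_strands js : uniq js ->
  \rank (X *m \sum_(j <- js) strand j) = (\sum_(j <- js) \rank (X *m strand j))%N.
Proof.
elim: js => [_|j js IH /= /andP[njs ujs]]; first by rewrite !big_nil mulmx0 mxrank0.
rewrite !big_cons -IH //; set S := \sum_(i <- js) _.
have jS : strand j *m S = 0.
  rewrite mulmx_sumr big_seq big1 // => i ijs; rewrite strandM.
  by case: eqP njs => // ->; rewrite ijs.
have Sj : S *m strand j = 0.
  rewrite mulmx_suml big_seq big1 // => i ijs; rewrite strandM.
  by case: eqP njs => // <-; rewrite ijs.
have SS : S *m S = S.
  rewrite {2}/S mulmx_sumr [RHS]big_seq big_seq; apply: eq_bigr => i ijs.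
  rewrite mulmx_suml (bigD1_seq i) //= big1 ?addr0 ?strandM ?eqxx // => k nki.
  by rewrite strandM (negPf nki).
have jj : strand j *m strand j = strand j by rewrite strandM eqxx.
rewrite -(mxrank_mul_ker _ (strand j)) -mulmxA mulmxDl jj Sj addr0; congr (_ + _)%N.
apply/eqmx_rank/andP; split.
  apply/rV_subP => u; rewrite sub_capmx => /andP[/submxP[a ->] /sub_kermxP].
  rewrite -!mulmxA mulmxDl jj Sj addr0 => e.
  by rewrite mulmxDr mulmxDr e add0r submxMl.
rewrite sub_capmx; apply/andP; split; last by apply/sub_kermxP; rewrite -mulmxA Sj mulmx0.
have -> : X *m S = X *m S *m (strand j + S) by rewrite -mulmxA mulmxDr Sj SS add0r.
apply: submxMr; rewrite mulmx_sumr summx_sub // => i _; exact: stableX.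
Qed.

Lemma sum_strand_cap : (\sum_(j <- undup [seq d k | k <- enum 'I_r]) \rank (strand j :&: X))%N = \rank X.
Proof.
under eq_bigr do rewrite rank_strand_cap.
rewrite -rank_strands ?undup_uniq // (_ : \sum_(j <- _) _ = 1%:M) ?mulmx1 //.
apply/matrixP => k l; rewrite summxE !mxE.
have dk : d k \in undup [seq d k | k <- enum 'I_r] by rewrite mem_undup map_f // mem_enum.
rewrite (bigD1_seq _ dk) ?undup_uniq //= big1 ?addr0 => [|j nj].
  by rewrite strandE eqxx andbT.
by rewrite strandE [d k == j]eq_sym (negPf nj) andbF.
Qed.

End Strands.

Section Betti.
Variables (K : fieldType) (n : nat).

Section Total.
Variables (M : gmod K n) (F : graded_free_resolution M).
Local Notation deg i := (@res_deg _ _ _ F i).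

Lemma strand_tor_diff i j :
  strand K (deg i.+1) j *m tor_diff F i = tor_diff F i *m strand K (deg i) j.
Proof.
apply/matrixP => k l; rewrite /strand mul_diag_mx mul_mx_diag !mxE.
have [->|nz] := eqVneq (res_diff F i k l finset.set0) 0; first by rewrite mul0r mulr0.
have := res_diff_homog (g := F) nz; rewrite cards0 => /esym/eqP; rewrite subr_eq0 => /eqP ->.
exact: mulrC.
Qed.

Lemma sum_res_tor_dim i :
  (\sum_(j \in [set: int]%classic) res_tor_dim F i.+1 j =
   \rank (tor_cycles F i.+1) - \rank (tor_diff F i.+1))%N.
Proof.
pose js := undup [seq deg i.+1 k | k <- enum 'I_(res_rank F i.+1)].
have sc j : (tor_cycles F i.+1 *m strand K (deg i.+1) j <= tor_cycles F i.+1)%MS.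
  by apply/sub_kermxP; rewrite -mulmxA strand_tor_diff mulmxA mulmx_ker mul0mx.
have sd j : (tor_diff F i.+1 *m strand K (deg i.+1) j <= tor_diff F i.+1)%MS.
  by rewrite -strand_tor_diff submxMl.
have dc : (tor_diff F i.+1 <= tor_cycles F i.+1)%MS.
  apply/sub_kermxP/row_matrixP => k; rewrite row_mul row0; apply/rowP => l.
  have /rowP/(_ l) : row k (res_diff F i.+1) *m res_diff F i = 0.
    by apply/res_exact; exists (delta_mx 0 k); rewrite rowE.
  rewrite !mxE => /(congr1 (fun x : extalg K n => x finset.set0)); rewrite sum_ffunE ffunE => e.
  by rewrite -[RHS]e; apply: eq_bigr => t _; rewrite ext_coef0M !mxE.
rewrite -(fsbig_widen [set` js] [set: int]%classic) //; last first.
  move=> j [_ /negP jjs] /=; rewrite /res_tor_dim (_ : tor_strand F i.+1 j = 0) ?cap0mx ?mxrank0 //.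
  apply/matrixP => k l; rewrite !mxE; case: eqP => [e|_]; last by rewrite mul0rn.
  by case: jjs; rewrite /= -e mem_undup map_f // mem_enum.
rewrite -fsbig_seq ?undup_uniq // -(sum_strand_cap sc) -(sum_strand_cap sd) -sumnB // => j _.
by apply: mxrankS; apply: capmxS.
Qed.

End Total.

Lemma betti_tens_homology (M : gmod K n) (P : right_resolution K n) (g : grep K n)
    (phi : grep_iso M g) i :
  betti M i.+1 = tens_homology (rr_diff P i) (rr_diff P i.+1) (grep_emod g).
Proof.
have [F eF] : exists F : graded_free_resolution M, tor_dim M = res_tor_dim F.
  have [F _] := graded_resolution_exists M.
  have /xgetPex := ex_intro (fun t => exists F : graded_free_resolution M, t = res_tor_dim F)
    _ (ex_intro _ F erefl).
  exact.
by rewrite /betti eF sum_res_tor_dim (tor_tens_homology F P phi).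
Qed.

Lemma betti_dual (M : gmod K n) : exists C : nat, forall i, (1 <= i)%N ->
  (betti (dual M) i <= C * betti M i)%N /\ (betti M i <= C * betti (dual M) i)%N.
Proof.
have [P] := right_resolution_exists K n.
have [g [phi phi_gr]] := gmod_grep M; have [phi'] := dual_grep_iso phi_gr.
exists (grep_dim g * grep_dim g)%N => -[//|i] _.
rewrite (betti_tens_homology P phi) (betti_tens_homology P phi') -!mulnA.
have DD : rr_diff P i *m rr_diff P i.+1 = 0.
  apply/matrixP => k l.
  have e : rr_diff P i *m (rr_diff P i.+1 *m delta_mx l (0 : 'I_1)) = 0.
    by apply/rr_exact; exists (delta_mx l 0).
  have := congr1 (fun y : 'cV_(rr_dim P i) => y k 0) e.
  by rewrite mulmxA -colE !mxE.
split; first exact: tens_homology_dual_le.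
exact: leq_trans (tens_homology_bidual g DD) (tens_homology_dual_le (grep_dual g) DD).
Qed.

Lemma complexity_le_betti (R : realType) (M N : gmod K n) (C : nat) :
  (forall i, (1 <= i)%N -> (betti N i <= C * betti M i)%N) ->
  forall c : nat,
  (exists alpha : R, forall i, (1 <= i)%N -> (betti M i)%:R <= alpha * i%:R ^ (c%:Z - 1)) ->
  (exists alpha : R, forall i, (1 <= i)%N -> (betti N i)%:R <= alpha * i%:R ^ (c%:Z - 1)).
Proof.
move=> le c [alpha hM]; exists (C%:R * alpha) => i i_gt0.
apply: (@le_trans _ _ (C * betti M i)%:R); first by rewrite ler_nat le.
by rewrite natrM -mulrA ler_wpM2l // hM.
Qed.

Lemma complexity_dual (R : realType) (M : gmod K n) : complexity M R = complexity (dual M) R.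
Proof.
have [C hC] := betti_dual M.
have set_eq : [set c : nat | exists alpha : R, forall i, (1 <= i)%N ->
      (betti M i)%:R <= alpha * i%:R ^ (c%:Z - 1)]%classic =
    [set c : nat | exists alpha : R, forall i, (1 <= i)%N ->
      (betti (dual M) i)%:R <= alpha * i%:R ^ (c%:Z - 1)]%classic.
  apply/seteqP; split=> c.
    exact: (complexity_le_betti (fun i h => (hC i h).1)).
  exact: (complexity_le_betti (fun i h => (hC i h).2)).
by rewrite /complexity set_eq.
Qed.

End Betti.

Theorem theorem4p3 (R : realType) (K : fieldType) (n : nat) (M : gmod K n)
    (M_neq0 : exists m : M, m != 0) :
  [/\ forall vs : seq (extalg K n), regular_seq M vs <-> regular_seq (dual M) vs,
      depth M = depth (dual M)
    & complexity M R = complexity (dual M) R].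
Proof.
have reg vs := regular_seq_dual vs M_neq0.
by split=> //; [exact: depth_regular_seq|exact: complexity_dual].
Qed.
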